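(* Let $(A,\mathfrak{m})$ be a complete (commutative) Noetherian local ring. Assume that $K^b_f(\operatorname{proj} A)$ has AR-triangles. Then: (1) if $A$ is Cohen-Macaulay then $A$ is Gorenstein; (2) if $\dim A = 1$ then $A$ is Gorenstein.
   Context: $K^b(\operatorname{proj} A)$ is the homotopy category of bounded complexes of finitely generated free $A$-modules, and $K^b_f(\operatorname{proj} A)$ is its full subcategory of complexes with finite length (total) cohomology. Let $\mathcal{C}$ be a Krull-Schmidt triangulated category with shift functor $\Sigma$. A triangle $N \xrightarrow{f} E \xrightarrow{g} M \xrightarrow{h} \Sigma N$ in $\mathcal{C}$ is a right AR-triangle (Auslander-Reiten triangle) ending at $M$ if (RAR1) $M,N$ are indecomposable; (RAR2) $h \neq 0$; (RAR3) for every indecomposable $D$ and every non-isomorphism $t\colon D \to M$ we have $h\circ t = 0$. A triangle $\Sigma^{-1}M \xrightarrow{w} N \xrightarrow{f} E \xrightarrow{g} M$ in $\mathcal{C}$ is a left AR-triangle starting at $N$ if (LAR1) $M,N$ are indecomposable; (LAR2) $w\neq 0$; (LAR3) for every indecomposable $D$ and every non-isomorphism $t\colon N\to D$ we have $t\circ w=0$. The category $\mathcal{C}$ has AR-triangles if for every indecomposable $M\in\mathcal{C}$ there exist a right AR-triangle ending at $M$ and a left AR-triangle starting at $M$. *)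

(* Defs.v *)
From HB Require Import structures.
From mathcomp Require Import all_boot all_order all_algebra zify.
From mathcomp Require Import boolp classical_sets.

Set Implicit Arguments.
Unset Strict Implicit.
Unset Printing Implicit Defensive.

Import Order.TTheory GRing.Theory Num.Theory.

Local Open Scope classical_set_scope.
Local Open Scope ring_scope.

(* Not necessarily proper; [idealr_closed] is the library's proper ideal. *)
Definition ideal (A : comNzRingType) (I : set A) : Prop :=
  @GRing.submod_closed A A^o [in I].

Definition prime_ideal (A : comNzRingType) (P : set A) : Prop :=
  idealr_closed [in P] /\ prime_idealr_closed [in P].

Definition maximal_ideal (A : comNzRingType) (M : set A) : Prop :=
  idealr_closed [in M] /\
  forall I : set A, idealr_closed [in I] -> M `<=` I -> I = M.

Definition local_ring (A : comNzRingType) (m : set A) : Prop :=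
  maximal_ideal m /\ forall m' : set A, maximal_ideal m' -> m' = m.

Definition ideal_gen (A : comNzRingType) (S : set A) : set A :=
  smallest (@ideal A) S.

Definition noetherian (A : comNzRingType) : Prop :=
  forall I : set A, ideal I -> exists s : seq A, I = ideal_gen [set` s].

Definition ideal_mul (A : comNzRingType) (I J : set A) : set A :=
  ideal_gen [set x * y | x in I & y in J].

Definition ideal_pow (A : comNzRingType) (I : set A) (n : nat) : set A :=
  iter n (ideal_mul I) setT.

(* Separated and complete for the [m]-adic topology. *)
Definition adic_complete (A : comNzRingType) (m : set A) : Prop :=
  (\bigcap_n ideal_pow m n = [set 0]) /\
  forall u : nat -> A,
    (forall n, exists N, forall i j, (N <= i)%N -> (N <= j)%N ->
       ideal_pow m n (u i - u j)) ->
    exists l : A, forall n, exists N, forall i, (N <= i)%N ->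
       ideal_pow m n (u i - l).

(* A chain [P 0 < ... < P n] of [n.+1] prime ideals. *)
Definition has_prime_chain (A : comNzRingType) (n : nat) : Prop :=
  exists P : nat -> set A,
    (forall k, (k <= n)%N -> prime_ideal (P k)) /\
    (forall k, (k < n)%N -> P k `<` P k.+1).

Definition krull_dim (A : comNzRingType) (n : nat) : Prop :=
  has_prime_chain A n /\ forall k, has_prime_chain A k -> (k <= n)%N.

(* [s`_k] is a nonzerodivisor on [A / (s`_0, ..., s`_(k-1))], and
   [A / (s) != 0]. *)
Definition regular_sequence (A : comNzRingType) (s : seq A) : Prop :=
  (forall k, (k < size s)%N -> forall a : A,
     ideal_gen [set` take k s] (s`_k * a) -> ideal_gen [set` take k s] a) /\
  ideal_gen [set` s] <> setT.

Definition has_regular_sequence (A : comNzRingType) (m : set A) (n : nat) :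
    Prop :=
  exists s : seq A, [/\ size s = n, [set` s] `<=` m & regular_sequence s].

Definition depth (A : comNzRingType) (m : set A) (n : nat) : Prop :=
  has_regular_sequence m n /\
  forall k, has_regular_sequence m k -> (k <= n)%N.

Definition cohen_macaulay (A : comNzRingType) (m : set A) : Prop :=
  exists n, krull_dim A n /\ depth m n.

Definition injective_module (A : comNzRingType) (E : lmodType A) : Prop :=
  forall (U V : lmodType A) (j : {linear U -> V}) (f : {linear U -> E}),
    injective j -> exists g : {linear V -> E}, forall x, g (j x) = f x.

(* [0 -> M -> I 0 -> I 1 -> ... -> I n -> 0] exact with injective [I k];
   the modules beyond [I n] are zero. *)
Definition injdim_le (A : comNzRingType) (M : lmodType A) (n : nat) : Prop :=
  exists (I : nat -> lmodType A) (e : {linear M -> I 0%N})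
         (d : forall k, {linear I k -> I k.+1}),
    [/\ forall k, injective_module (I k),
        forall k, (n < k)%N -> forall x : I k, x = 0,
        injective e,
        forall x, d 0%N x = 0 <-> exists y, e y = x
      & forall k x, d k.+1 x = 0 <-> exists y, d k y = x].

Definition gorenstein (A : comNzRingType) : Prop :=
  exists n, @injdim_le A A^o n.

(* [Z / B] has finite length, for submodules [B <= Z] of [V]; submodules of
   [Z / B] are represented by the submodules of [V] between [B] and [Z], and
   [B = F 0 < F 1 < ... < F n = Z] is a composition series. *)
Definition finite_length_quotient (A : comNzRingType) (V : lmodType A)
    (Z B : set V) : Prop :=
  exists (n : nat) (F : nat -> set V),
    [/\ F 0%N = B, F n = Z,
        forall k, (k <= n)%N -> GRing.submod_closed [in F k]
      & forall k, (k < n)%N -> F k `<` F k.+1 /\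
          forall W : set V, GRing.submod_closed [in W] ->
            F k `<=` W -> W `<=` F k.+1 -> W = F k \/ W = F k.+1].

(* The term of (cohomological) degree [i] is the free module [A^(rk i)] of row
   vectors, on which matrices act by right multiplication: [M *m N] is
   "[M], then [N]". *)
Record bcomplex (A : comNzRingType) := BComplex {
  rk : int -> nat;
  diff : forall i, 'M[A]_(rk i, rk (i + 1));
  diff_diff : forall i, diff i *m diff (i + 1) = 0;
  rk_bounded : exists n : nat, forall i : int, (n < `|i|)%N -> rk i = 0%N
}.

Record chmap (A : comNzRingType) (X Y : bcomplex A) := ChMap {
  chmap_fun :> forall i, 'M[A]_(rk X i, rk Y i);
  chmap_comm : forall i, chmap_fun i *m diff Y i = diff X i *m chmap_fun (i + 1)
}.

(* [f - g = d s + s d], written in degree [i + 1]; the homotopy component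
   [s i] goes from degree [i + 1] to degree [i]. *)
Definition homotopic (A : comNzRingType) (X Y : bcomplex A) (f g : chmap X Y) :
    Prop :=
  exists s : forall i, 'M[A]_(rk X (i + 1), rk Y i),
    forall i, f (i + 1) - g (i + 1) =
      diff X (i + 1) *m s (i + 1) + s i *m diff Y i.

Lemma ch_id_subproof (A : comNzRingType) (X : bcomplex A) i :
  1%:M *m diff X i = diff X i *m 1%:M.
Proof. by rewrite mul1mx mulmx1. Qed.

Definition ch_id (A : comNzRingType) (X : bcomplex A) : chmap X X :=
  ChMap (@ch_id_subproof A X).

Lemma ch_zero_subproof (A : comNzRingType) (X Y : bcomplex A) i :
  (0 : 'M[A]_(rk X i, rk Y i)) *m diff Y i = diff X i *m 0.
Proof. by rewrite mul0mx mulmx0. Qed.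

Definition ch_zero (A : comNzRingType) (X Y : bcomplex A) : chmap X Y :=
  ChMap (@ch_zero_subproof A X Y).

Lemma ch_comp_subproof (A : comNzRingType) (X Y Z : bcomplex A)
    (g : chmap Y Z) (f : chmap X Y) i :
  (f i *m g i) *m diff Z i = diff X i *m (f (i + 1) *m g (i + 1)).
Proof. by rewrite -mulmxA chmap_comm mulmxA chmap_comm mulmxA. Qed.

Definition ch_comp (A : comNzRingType) (X Y Z : bcomplex A)
    (g : chmap Y Z) (f : chmap X Y) : chmap X Z :=
  ChMap (ch_comp_subproof g f).

(* Isomorphisms and zero objects of the homotopy category. *)
Definition ch_iso (A : comNzRingType) (X Y : bcomplex A) (f : chmap X Y) :
    Prop :=
  exists g : chmap Y X,
    homotopic (ch_comp g f) (ch_id X) /\ homotopic (ch_comp f g) (ch_id Y).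

Definition isomorphic (A : comNzRingType) (X Y : bcomplex A) : Prop :=
  exists f : chmap X Y, ch_iso f.

Definition is_zero (A : comNzRingType) (X : bcomplex A) : Prop :=
  homotopic (ch_id X) (ch_zero X X).

Lemma dsum_subproof (A : comNzRingType) (X Y : bcomplex A) i :
  block_mx (diff X i) 0 0 (diff Y i) *m
  block_mx (diff X (i + 1)) 0 0 (diff Y (i + 1)) = 0.
Proof.
by rewrite mulmx_block !diff_diff !mul0mx !mulmx0 !addr0 block_mx_const.
Qed.

Lemma dsum_bounded (A : comNzRingType) (X Y : bcomplex A) :
  exists n : nat, forall i : int, (n < `|i|)%N -> (rk X i + rk Y i = 0)%N.
Proof.
have [n Hn] := rk_bounded X; have [p Hp] := rk_bounded Y.
by exists (n + p)%N => i Hi; rewrite Hn ?Hp //; lia.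
Qed.

Definition dsum (A : comNzRingType) (X Y : bcomplex A) : bcomplex A :=
  BComplex (dsum_subproof X Y) (dsum_bounded X Y).

Lemma shift_subproof (A : comNzRingType) (X : bcomplex A) i :
  - diff X (i + 1) *m - diff X (i + 1 + 1) = 0.
Proof. by rewrite mulNmx mulmxN diff_diff !oppr0. Qed.

Lemma shift_bounded (A : comNzRingType) (X : bcomplex A) :
  exists n : nat, forall i : int, (n < `|i|)%N -> rk X (i + 1) = 0%N.
Proof.
by have [n Hn] := rk_bounded X; exists n.+1 => i Hi; apply: Hn; lia.
Qed.

Definition shift (A : comNzRingType) (X : bcomplex A) : bcomplex A :=
  BComplex (shift_subproof X) (shift_bounded X).

Lemma shift_map_subproof (A : comNzRingType) (X Y : bcomplex A)
    (f : chmap X Y) i :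
  f (i + 1) *m diff (shift Y) i = diff (shift X) i *m f (i + 1 + 1).
Proof. by rewrite /= mulmxN mulNmx chmap_comm. Qed.

Definition shift_map (A : comNzRingType) (X Y : bcomplex A) (f : chmap X Y) :
    chmap (shift X) (shift Y) :=
  @ChMap A (shift X) (shift Y) (fun i => f (i + 1)) (shift_map_subproof f).

(* In degree [i] the differential of the inverse shift is [- diff X (i - 1)],
   whose codomain has degree [i - 1 + 1 = i + 1 - 1]. *)
Definition unshift_diff (A : comNzRingType) (X : bcomplex A) (i : int) :
    'M[A]_(rk X (i - 1), rk X (i + 1 - 1)) :=
  castmx (erefl, congr1 (rk X) (addrAC i (-1) 1)) (- diff X (i - 1)).

Lemma unshift_subproof (A : comNzRingType) (X : bcomplex A) i :
  unshift_diff X i *m unshift_diff X (i + 1) = 0.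
Proof.
rewrite /unshift_diff.
move: (addrAC i (-1) 1) (addrAC (i + 1) (-1) 1).
move: (i + 1 - 1) (i + 1 + 1 - 1) => j k e e'.
subst j k; rewrite !castmx_id mulNmx mulmxN diff_diff !oppr0 //.
Qed.

Lemma unshift_bounded (A : comNzRingType) (X : bcomplex A) :
  exists n : nat, forall i : int, (n < `|i|)%N -> rk X (i - 1) = 0%N.
Proof.
by have [n Hn] := rk_bounded X; exists n.+1 => i Hi; apply: Hn; lia.
Qed.

Definition unshift (A : comNzRingType) (X : bcomplex A) : bcomplex A :=
  BComplex (unshift_subproof X) (unshift_bounded X).

(* The canonical identification of [X] with [shift (unshift X)], whose terms
   are [A^(rk X i)] and [A^(rk X (i + 1 - 1))]. *)
Definition unshiftK_fun (A : comNzRingType) (X : bcomplex A) (i : int) :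
    'M[A]_(rk X i, rk (shift (unshift X)) i) :=
  castmx (erefl, congr1 (rk X) (esym (addrK 1 i))) 1%:M.

Lemma unshiftK_subproof (A : comNzRingType) (X : bcomplex A) i :
  unshiftK_fun X i *m diff (shift (unshift X)) i =
  diff X i *m unshiftK_fun X (i + 1).
Proof.
rewrite /= /unshiftK_fun /unshift_diff /=.
move: (addrAC (i + 1) (-1) 1) (esym (addrK 1 i)) (esym (addrK 1 (i + 1))).
move: (i + 1 - 1) (i + 1 + 1 - 1) => j k e e0 e1.
subst j k; rewrite (eq_irrelevance e1 erefl) !castmx_id mul1mx mulmx1.
by rewrite opprK.
Qed.

Definition unshiftK (A : comNzRingType) (X : bcomplex A) :
    chmap X (shift (unshift X)) :=
  @ChMap A X (shift (unshift X)) (unshiftK_fun X) (@unshiftK_subproof A X).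

(* [cone f] is [X (i + 1) (+) Y i] in degree [i], with differential
   [(x, y) |-> (- d x, f x + d y)]. *)
Definition cone_diff (A : comNzRingType) (X Y : bcomplex A) (f : chmap X Y)
    (i : int) :
    'M[A]_(rk X (i + 1) + rk Y i, rk X (i + 1 + 1) + rk Y (i + 1)) :=
  block_mx (- diff X (i + 1)) (f (i + 1)) 0 (diff Y i).

Lemma cone_subproof (A : comNzRingType) (X Y : bcomplex A) (f : chmap X Y) i :
  cone_diff f i *m cone_diff f (i + 1) = 0.
Proof.
rewrite /cone_diff mulmx_block !mul0mx !mulmx0 !addr0 !diff_diff.
rewrite mulNmx mulmxN diff_diff !oppr0 mulNmx chmap_comm addNr add0r.
by rewrite block_mx_const.
Qed.

Lemma cone_bounded (A : comNzRingType) (X Y : bcomplex A) :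
  exists n : nat, forall i : int, (n < `|i|)%N ->
    (rk X (i + 1) + rk Y i = 0)%N.
Proof.
have [n Hn] := rk_bounded X; have [p Hp] := rk_bounded Y.
by exists (n + p).+1 => i Hi; rewrite Hn ?Hp //; lia.
Qed.

Definition cone (A : comNzRingType) (X Y : bcomplex A) (f : chmap X Y) :
    bcomplex A :=
  BComplex (cone_subproof f) (cone_bounded X Y).

Lemma cone_in_subproof (A : comNzRingType) (X Y : bcomplex A)
    (f : chmap X Y) i :
  row_mx 0 1%:M *m diff (cone f) i =
  diff Y i *m (row_mx 0 1%:M : 'M_(_, rk X (i + 1 + 1) + rk Y (i + 1))).
Proof.
rewrite /= /cone_diff mul_row_block mul_mx_row !mul0mx !mul1mx !mulmx0 mulmx1.
by rewrite !add0r.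
Qed.

Definition cone_in (A : comNzRingType) (X Y : bcomplex A) (f : chmap X Y) :
    chmap Y (cone f) :=
  @ChMap A Y (cone f) (fun i => row_mx 0 1%:M) (cone_in_subproof f).

Lemma cone_out_subproof (A : comNzRingType) (X Y : bcomplex A)
    (f : chmap X Y) i :
  (col_mx 1%:M 0 : 'M_(rk X (i + 1) + rk Y i, _)) *m diff (shift X) i =
  diff (cone f) i *m col_mx 1%:M 0.
Proof.
rewrite /= /cone_diff mul_block_col mul_col_mx !mul0mx !mul1mx !mulmx0 mulmx1.
by rewrite !addr0.
Qed.

Definition cone_out (A : comNzRingType) (X Y : bcomplex A) (f : chmap X Y) :
    chmap (cone f) (shift X) :=
  @ChMap A (cone f) (shift X) (fun i => col_mx 1%:M 0) (cone_out_subproof f).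

(* [X -> Y -> Z -> shift X] is isomorphic, in the homotopy category, to
   [X' -> Y' -> cone u -> shift X'] for some chain map [u : X' -> Y']. *)
Definition distinguished (A : comNzRingType) (X Y Z : bcomplex A)
    (f : chmap X Y) (g : chmap Y Z) (h : chmap Z (shift X)) : Prop :=
  exists (X' Y' : bcomplex A) (u : chmap X' Y')
         (a : chmap X X') (b : chmap Y Y') (c : chmap Z (cone u)),
    [/\ [/\ ch_iso a, ch_iso b & ch_iso c],
        homotopic (ch_comp b f) (ch_comp u a),
        homotopic (ch_comp c g) (ch_comp (cone_in u) b)
      & homotopic (ch_comp (shift_map a) h) (ch_comp (cone_out u) c)].

(* Cohomology in degree [i + 1]; all degrees are of this form. *)
Definition finite_length_cohomology (A : comNzRingType) (X : bcomplex A) :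
    Prop :=
  forall i, @finite_length_quotient A 'rV[A]_(rk X (i + 1))
    [set z | z *m diff X (i + 1) = 0]
    [set y *m diff X i | y in setT].

(* Objects of the full subcategory of the homotopy category given by the
   complexes with finite length cohomology. *)
Record kbf (A : comNzRingType) := Kbf {
  kbf_complex :> bcomplex A;
  kbf_finite_length : finite_length_cohomology kbf_complex
}.

Definition indecomposable (A : comNzRingType) (X : kbf A) : Prop :=
  ~ is_zero X /\
  forall Y Z : kbf A, isomorphic X (dsum Y Z) -> is_zero Y \/ is_zero Z.

Definition right_AR_triangle (A : comNzRingType) (N E M : kbf A)
    (f : chmap N E) (g : chmap E M) (h : chmap M (shift N)) : Prop :=
  [/\ distinguished f g h,
      indecomposable M /\ indecomposable N,
      ~ homotopic h (ch_zero M (shift N))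
    & forall (D : kbf A) (t : chmap D M), indecomposable D -> ~ ch_iso t ->
        homotopic (ch_comp h t) (ch_zero D (shift N))].

(* A triangle [unshift M -> N -> E -> M] is one in the sense of
   [distinguished] once [M] is identified with [shift (unshift M)]. *)
Definition left_AR_triangle (A : comNzRingType) (N E M : kbf A)
    (w : chmap (unshift M) N) (f : chmap N E) (g : chmap E M) : Prop :=
  [/\ distinguished w f (ch_comp (unshiftK M) g),
      indecomposable M /\ indecomposable N,
      ~ homotopic w (ch_zero (unshift M) N)
    & forall (D : kbf A) (t : chmap N D), indecomposable D -> ~ ch_iso t ->
        homotopic (ch_comp t w) (ch_zero (unshift M) D)].

Definition has_AR_triangles (A : comNzRingType) : Prop :=
  forall M : kbf A, indecomposable M ->
    (exists (N E : kbf A) (f : chmap N E) (g : chmap E M)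
       (h : chmap M (shift N)), right_AR_triangle f g h) /\
    (exists (E L : kbf A) (w : chmap (unshift L) M) (f : chmap M E)
       (g : chmap E L), left_AR_triangle w f g).

(* Main.v *)
Require Import Defs.
From HB Require Import structures.
From mathcomp Require Import all_boot all_order all_algebra zify.
From mathcomp Require Import boolp classical_sets generic_quotient ring_quotient.

Set Implicit Arguments.
Unset Strict Implicit.
Unset Printing Implicit Defensive.

Import Order.TTheory GRing.Theory Num.Theory.

Local Open Scope classical_set_scope.
Local Open Scope ring_scope.

(** The theorem holds because AR-triangles in the category of perfect complexes
    with finite length cohomology force [A] to have finite injective dimension,
    and they do so one indecomposable object at a time.

    Let [W -> N] be the first map of a left AR-triangle starting at [N]. A map
    [g : Y -> N] that is not null-homotopic has a cone in the category, and the
    map [N -> cone g] is not a split monomorphism; so it kills [W -> N], which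
    therefore factors through [g]. Hence [Y] receives a nonzero map from [W]
    as soon as it has a nonzero map to [N] ([left_AR_all_null]). But [W] is a
    bounded complex of free modules, living in degrees between [- b] and [b],
    say: if [Y] is exact in these degrees, then [Hom(W, Y) = 0], and so
    [Hom(Y, N) = 0]. Decomposing into indecomposables, every [X] of the category
    has a bound [c] such that [Hom(Y, X) = 0] for all [Y] of the category that
    are exact in degrees between [- c] and [c] ([AR_exact_all_null]).

    Both [Y] and [X] can be freed from the finite length condition. The Koszul
    complex on generators of [m], with coefficients in any bounded complex of
    free modules, has finite length cohomology. Multiplication by [a] on
    [Hom(Y, X)] is surjective when maps to or from the cone of [a] vanish, and
    then [Hom(Y, X) = 0] because [A] is complete and [a] belongs to [m]
    ([divisible_all_null]). Removing the generators one after the other gives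
    the vanishing of [Hom(Y, A)] for all bounded [Y] that are exact in a fixed
    range of degrees around [0] ([exact_near0_all_null]).

    Applied to truncated free resolutions of [A / J], suitably shifted, this
    says that one and the same [Ext] group of [A / J] with coefficients in [A]
    vanishes for all ideals [J]. Dimension shifting along an injective
    resolution of [A], and Baer's criterion, then show that some cosyzygy of [A]
    is injective ([cocycles_bound_injdim]).

    The decomposition into indecomposables terminates because the total
    dimension of the cohomology over the residue field is additive and vanishes
    only on contractible complexes ([kbf_ind]). Injective modules are obtained
    by coinduction from the divisible group Q/Z. *)

(** * Submodules, ideals and local rings *)

(** The closure conditions on ideals, on terms of composition series and on
    kernels of matrices, read as one proposition on classical sets. *)
Definition submodule (R : pzRingType) (V : lmodType R) (S : set V) : Prop :=
  S 0 /\ forall a x y, S x -> S y -> S (a *: x + y).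

Section Submodules.
Variables (R : pzRingType) (V : lmodType R).

Lemma submod_closedP (S : set V) : GRing.submod_closed [in S] <-> submodule S.
Proof.
split=> [[S0 SZD]|[S0 SZD]].
  split=> [|a x y Sx Sy]; first exact: set_mem.
  exact/set_mem/SZD/mem_set/Sy/mem_set.
split=> [|a x y Sx Sy]; first exact/mem_set.
exact/mem_set/SZD/set_mem/Sy/set_mem.
Qed.

Variable S : set V.
Hypothesis subS : submodule S.

Lemma submodZ a x : S x -> S (a *: x).
Proof.
by move=> Sx; rewrite -[_ *: _]addr0; apply: subS.2 => //; exact: subS.1.
Qed.
Lemma submodD x y : S x -> S y -> S (x + y).
Proof. by move=> Sx Sy; rewrite -[x]scale1r; apply: subS.2. Qed.
Lemma submodN x : S x -> S (- x).
Proof. by move=> Sx; rewrite -scaleN1r; apply: submodZ. Qed.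
Lemma submodB x y : S x -> S y -> S (x - y).
Proof. by move=> Sx Sy; apply/submodD/submodN. Qed.
Lemma submod_sum (I : Type) (r : seq I) (F : I -> V) :
  (forall i, S (F i)) -> S (\sum_(i <- r) F i).
Proof.
by move=> SF; elim/big_ind: _ => // [|x y]; [exact: subS.1 | exact: submodD].
Qed.
End Submodules.

Lemma idealP (A : comNzRingType) (I : set A) :
  ideal I <-> @submodule A A^o I.
Proof. exact: submod_closedP. Qed.

Lemma idealrP (A : comNzRingType) (I : set A) :
  idealr_closed [in I] <-> @submodule A A^o I /\ ~ I 1.
Proof.
split=> [[I0 I1 IZ]|[[I0 IZ] I1]].
  split; last by move=> /mem_set; exact/negP.
  split=> [|a x y Ix Iy]; first exact: set_mem.
  exact/set_mem/IZ/mem_set/Iy/mem_set.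
split=> [||a x y Ix Iy]; first exact/mem_set.
  by apply/negP => /set_mem.
exact/mem_set/IZ/set_mem/Iy/set_mem.
Qed.

Lemma ideal_gen_seqP (A : comNzRingType) (s : seq A) x :
  ideal_gen [set` s] x ->
  exists c : 'rV[A]_(size s), x = \sum_i c 0 i * s`_i.
Proof.
move=> /(_ [set x | exists c : 'rV[A]_(size s), x = \sum_i c 0 i * s`_i]).
apply; split=> [|y /= /(nthP 0) [i lti <-]].
  apply/idealP; split=> [|a y z [c ->] [d ->]].
    by exists 0; rewrite big1 // => i _; rewrite mxE mul0r.
  exists (a *: c + d); rewrite scaler_sumr -big_split /=.
  by apply: eq_bigr => i _; rewrite !mxE mulrDl -mulrA.
exists (delta_mx 0 (Ordinal lti)).
rewrite (bigD1 (Ordinal lti)) //= mxE !eqxx mul1r big1 ?addr0 // => j jNi.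
by rewrite mxE (negbTE jNi) andbF mul0r.
Qed.

Lemma ideal_gen_sub (A : comNzRingType) (S : set A) : S `<=` ideal_gen S.
Proof. by move=> x Sx I [_]; apply. Qed.

Lemma ideal_gen_min (A : comNzRingType) (S I : set A) :
  @submodule A A^o I -> S `<=` I -> ideal_gen S `<=` I.
Proof. by move=> /idealP iI SI x /(_ I); apply. Qed.

Section LocalRing.
Variables (A : comNzRingType) (m : set A).
Hypothesis A_local : local_ring m.

Lemma local_ideal : @submodule A A^o m /\ ~ m 1.
Proof. by apply/idealrP; case: A_local => -[]. Qed.

Lemma local_mul a x : m x -> m (a * x).
Proof. by have [mS _] := local_ideal; apply: (submodZ mS). Qed.

(** By Zorn's lemma [I] lies in an ideal that is maximal among the proper ones,
    and [m] is the only such ideal. *)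
Lemma proper_ideal_sub_local (I : set A) :
  @submodule A A^o I -> ~ I 1 -> I `<=` m.
Proof.
move=> iI I1.
(* The empty set is admitted because it is the union of the empty chain. *)
pose P (J : set A) := J = set0 \/ [/\ I `<=` J, @submodule A A^o J & ~ J 1].
have [F FP Ftot|M [[->|[IM iM M1]] Mmax]] := @Zorn_bigcup A P.
- have [[J FJ J0]|noJ] := pselect (exists2 J, F J & J <> set0); last first.
    left; rewrite predeqE => x; split => // -[J FJ Jx].
    by case: noJ; exists J => // J0; rewrite J0 in Jx.
  right; split=> [x Ix|| [K FK K1]].
  + by exists J => //; case: (FP J FJ) => // -[+ _ _]; apply.
  + split; first by exists J => //; case: (FP J FJ) => // -[_ [] ].
    move=> a x y [K FK Kx] [L FL Ly].
    have sub K' (z : A) : F K' -> K' z -> @submodule A A^o K'.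
      by move=> FK'; case: (FP K' FK') => [->|[] //].
    case: (Ftot K L FK FL) => [KL|LK].
      by exists L => //; apply: (sub L y FL Ly).2 => //; apply: KL.
    by exists K => //; apply: (sub K x FK Kx).2 => //; apply: LK.
  + by case: (FP K FK) => [K0|[_ _]//]; rewrite K0 in K1.
- case: (Mmax I); last by right; split.
  by split=> // /(_ 0); apply; exact: iI.1.
- suff <- : M = m by [].
  apply: A_local.2; split; first exact/idealrP.
  move=> J /idealrP [iJ J1] MJ; apply/eqP; case: eqP => // JM; exfalso.
  apply: (Mmax J); last by right; split=> // x /IM; apply: MJ.
  by split=> // JM'; apply: JM; rewrite eqEsubset.
Qed.

Lemma local_unit a : ~ m a -> exists b, a * b = 1.
Proof.
move=> ma; pose I := [set x | exists b, x = a * b].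
have iI : @submodule A A^o I.
  split=> [|c x y [b ->] [b' ->]]; first by exists 0; rewrite mulr0.
  by exists (c * b + b'); rewrite mulrDr; congr (_ + _); exact: mulrCA.
have [[b ->]|I1] := pselect (I 1); first by exists b.
by case: ma; apply: (proper_ideal_sub_local iI I1); exists 1; rewrite mulr1.
Qed.

Lemma local_unit1D a : m a -> exists b, (1 - a) * b = 1.
Proof.
move=> ma; apply: local_unit => m1a; apply: local_ideal.2.
by rewrite -(subrK a 1); apply: (submodD local_ideal.1).
Qed.

(** An abstract field with a surjection suffices: matrices over the residue
    field only occur as reductions of matrices over [A]. *)
Lemma residue_field : exists (k : fieldType) (p : {rmorphism A -> k}),
  (forall y, exists x, p x = y) /\ (forall x, p x = 0 <-> m x).
Proof.
pose HI := isIdealr.Build A (fun x => x \in m) A_local.1.1.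
pose I : idealr A := HB.pack (fun x => x \in m) HI.
pose Q : comNzRingType := {ideal_quot I}.
have piK (x y : A) : ((\pi_Q x)%qT == (\pi_Q y)%qT) = ((x - y) \in m).
  by rewrite -Quotient.idealrBE.
have p0 x : (\pi_Q x)%qT = 0 <-> m x.
  rewrite -(rmorph0 (\pi_Q)%qT); split=> [/eqP|mx]; first by rewrite piK subr0 => /set_mem.
  by apply/eqP; rewrite piK subr0; apply/mem_set.
have ex_inv (x : Q) : exists y : Q, x != 0 -> y * x = 1.
  have [->|x0] := eqVneq x 0; first by exists 0.
  have [|b ab] := @local_unit (repr x).
    by move=> /p0; rewrite reprK => xx; rewrite xx eqxx in x0.
  exists (\pi_Q b)%qT => _; rewrite -[X in _ * X]reprK -rmorphM mulrC.
  by rewrite ab rmorph1.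
have [inv0 invP0] := choice ex_inv.
pose inv x := if x == 0 then 0 else inv0 x.
have invP (x : Q) : x != 0 -> inv x * x = 1.
  by move=> x0; rewrite /inv (negbTE x0); apply: invP0.
have inv0E : inv 0 = 0 by rewrite /inv eqxx.
pose HF := GRing.ComNzRing_isField.Build Q invP inv0E.
pose k : fieldType := HB.pack Q HF.
exists k, ((\pi_Q)%qT : {rmorphism A -> Q}); split=> // y.
by exists (repr y); rewrite /= reprK.
Qed.

End LocalRing.

(** * Noetherian rings and finite length *)

Section Noetherian.
Variable A : comNzRingType.
Hypothesis A_noeth : noetherian A.

(** Induction on the rank: the first coordinates of the vectors of [S] form an
    ideal, and the vectors with first coordinate zero a submodule in one
    dimension less; lifted generators of both generate [S]. *)
Lemma noetherian_rows n (S : set 'rV[A]_n) : submodule S ->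
  exists (q : nat) (G : 'M[A]_(q, n)), forall x, S x <-> exists y, x = y *m G.
Proof.
elim: n S => [|n IHn] S subS.
  exists 0%N, 0 => x; split=> [_|_]; first by exists 0; apply/matrixP => ? [].
  by rewrite (_ : x = 0); [exact: subS.1 | apply/matrixP => ? []].
rewrite -[n.+1]/(1 + n)%N in S subS *.
pose I := [set a : A | exists2 x, S x & x 0 0 = a].
have iI : @submodule A A^o I.
  split=> [|a _ _ [x Sx <-] [y Sy <-]].
    by exists 0; rewrite ?mxE //; exact: subS.1.
  by exists (a *: x + y); [exact: subS.2 | rewrite !mxE].
have [s Is] := A_noeth ((idealP I).2 iI).
have /choice [g gP] (i : 'I_(size s)) : exists x, S x /\ x 0 0 = s`_i.
  have /(_ s`_i) [|x Sx <-] : [set` s] `<=` I by rewrite Is; exact: ideal_gen_sub.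
    by apply: mem_nth.
  by exists x.
pose T := [set v : 'rV_n | S (row_mx 0 v)].
have subT : submodule T.
  split=> [|a x y Tx Ty]; first by rewrite /T /= row_mx0; exact: subS.1.
  rewrite /T /= (_ : row_mx _ _ = a *: row_mx 0 x + row_mx 0 y).
    exact: subS.2.
  by rewrite scale_row_mx add_row_mx scaler0 addr0.
have [q [G GP]] := IHn T subT.
exists (size s + q)%N, (col_mx (\matrix_i g i) (row_mx 0 G)) => x.
split=> [Sx|[y ->]].
  have : I (x 0 0) by exists x.
  rewrite Is => /ideal_gen_seqP [c xc].
  pose z := x - c *m \matrix_i g i.
  have gS : S (c *m \matrix_i g i).
    rewrite mulmx_sum_row; apply: submod_sum => // i; apply: submodZ => //.
    by rewrite rowK; case: (gP i).
  have z0 : lsubmx z = 0.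
    apply/matrixP => i j; rewrite !ord1 !mxE [lshift _ _](_ : _ = 0).
      2: exact: val_inj.
    rewrite xc [X in _ - X](eq_bigr (fun i => c 0 i * s`_i)) ?subrr // => k _.
    by rewrite mxE; case: (gP k) => _ ->.
  have /GP [y yE] : T (rsubmx z).
    by rewrite /T /= -z0 hsubmxK; apply: submodB.
  exists (row_mx c y).
  rewrite mul_row_col mul_mx_row mulmx0 -yE -z0 hsubmxK /z addrC subrK //.
rewrite -[y]hsubmxK mul_row_col; apply: submodD => //.
  rewrite mulmx_sum_row; apply: submod_sum => // i; apply: submodZ => //.
  by rewrite rowK; case: (gP i).
rewrite mul_mx_row mulmx0; suff : T (rsubmx y *m G) by [].
by apply/GP; exists (rsubmx y).
Qed.

(** A strictly ascending chain of submodules cannot exist: its union is generated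
    by the rows of a matrix, all of which already lie in one of its terms. *)
Lemma noetherian_ind n (P : set 'rV[A]_n -> Prop) :
  (forall B, submodule B -> (forall C, submodule C -> B `<` C -> P C) -> P B) ->
  forall B, submodule B -> P B.
Proof.
move=> PS B0 subB0; apply: contrapT => nPB0.
pose bad := {B : set 'rV[A]_n | submodule B /\ ~ P B}.
have next (B : bad) : {C : bad | sval B `<` sval C}.
  apply/cid; apply: contrapT; case: B => B [subB nPB] /= noC.
  apply: (nPB); apply: PS => // C subC BC; apply: contrapT => nPC.
  by apply: noC; exists (exist _ C (conj subC nPC)).
have [F [_ FS]] := dependent_choice next (exist _ B0 (conj subB0 nPB0)).
have Fmono i j : (i <= j)%N -> sval (F i) `<=` sval (F j).
  elim: j => [|j IHj]; first by rewrite leqn0 => /eqP ->.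
  rewrite leq_eqVlt => /predU1P [-> //|/IHj ij].
  by apply: (subset_trans ij); case: (FS j).
pose U := \bigcup_i sval (F i).
have subF i : submodule (sval (F i)) by case: (F i) => ? [].
have subU : submodule U.
  split=> [|a x y [i _ ix] [j _ jy]]; first by exists 0%N => //; exact: (subF _).1.
  exists (maxn i j) => //; apply: (subF _).2.
    exact: Fmono (leq_maxl _ _) _ ix.
  exact: Fmono (leq_maxr _ _) _ jy.
have [q [G GP]] := noetherian_rows subU.
have /choice [N NP] (i : 'I_q) : exists N, sval (F N) (row i G).
  have [N _ NG] : U (row i G) by apply/GP; exists (delta_mx 0 i); rewrite -rowE.
  by exists N.
pose M := (\max_i N i)%N.
have [_] := FS M; apply => x Fx.
have /GP [y ->] : U x by exists M.+1.
rewrite mulmx_sum_row; apply: submod_sum => // i; apply: submodZ => //.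
by apply: Fmono (NP i); exact: leq_bigmax.
Qed.

End Noetherian.

Section FiniteLength.
Variables (A : comNzRingType) (m : set A).
Hypotheses (A_local : local_ring m) (A_noeth : noetherian A).

(** Multiplication by an element [a] of [m] moves each term of a composition
    series into the previous one: otherwise [z] and [a *: z] generate the same
    simple quotient, so [z = c *: (a *: z)] there, while [1 - c * a] is a
    unit. *)
Lemma finite_length_nilpotent (V : lmodType A) (Z B : set V) :
  finite_length_quotient Z B ->
  forall a, m a -> exists n, forall z, Z z -> B (a ^+ n *: z).
Proof.
case=> n [F [<- <- Fsub FS]] a ma; exists n.
have {}Fsub k : (k <= n)%N -> submodule (F k) by move=> /Fsub /submod_closedP.
have step k : (k < n)%N -> forall z, F k.+1 z -> F k (a *: z).
  move=> kn z Fz; apply: contrapT => naz.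
  have [[ssub _] simple] := FS k kn.
  have subk := Fsub k (ltnW kn); have subk1 := Fsub k.+1 kn.
  pose W := [set w | exists c v, F k v /\ w = c *: (a *: z) + v].
  have subW : submodule W.
    split=> [|b _ _ [c [v [Fv ->]]] [d [u [Fu ->]]]].
      by exists 0, 0; rewrite scale0r addr0; split=> //; exact: subk.1.
    exists (b * c + d), (b *: v + u); split; first exact: subk.2.
    by rewrite scalerDr scalerDl -[(b * c) *: _]scalerA addrACA.
  have [| |WF|WF] := simple W ((submod_closedP W).2 subW).
  - by move=> v Fv; exists 0, v; rewrite scale0r add0r.
  - move=> _ [c [v [Fv ->]]]; apply: subk1.2; last exact: ssub.
    exact: submodZ.
  - apply: naz; rewrite -WF; exists 1, 0; rewrite scale1r addr0; split=> //.
    exact: subk.1.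
  - have : W z by rewrite WF.
    move=> [c [v [Fv zE]]].
    have [d dE] := local_unit1D A_local (local_mul A_local c ma).
    apply: naz; apply: submodZ => //.
    rewrite -[z]scale1r -dE mulrC -scalerA; apply: submodZ => //.
    by rewrite scalerBl scale1r -scalerA {1}zE addrC addKr.
have step' : forall k, (k <= n)%N -> forall z, F n z -> F (n - k)%N (a ^+ k *: z).
  elim=> [|k IHk] kn z Fz; first by rewrite subn0 scale1r.
  rewrite exprS -scalerA; apply: step; first by lia.
  by rewrite -subSn // subSS; apply: IHk => //; exact: ltnW.
by move=> z Fz; rewrite -(subnn n); exact: step'.
Qed.

Lemma local_fg : exists s : seq A, m = ideal_gen [set` s].
Proof. by apply: A_noeth; apply/idealP; exact: (local_ideal A_local).1. Qed.

(** A composition series is built upwards from [B]: as long as [B <> Z], an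
    element of [Z] outside [B], multiplied by suitable powers of the generators
    of [m], generates a simple submodule modulo [B]. *)
Lemma nilpotent_finite_length n (Z B : set 'rV[A]_n) :
  submodule Z -> submodule B -> B `<=` Z ->
  (forall a, m a -> exists e, forall z, Z z -> B (a ^+ e *: z)) ->
  finite_length_quotient Z B.
Proof.
move=> subZ; move: B; apply: (noetherian_ind A_noeth) => B subB IH BZ nil.
have [ZB|nZB] := pselect (Z `<=` B).
  exists 0%N, (fun=> B); split=> //; first by apply/seteqP.
  by move=> _ _; apply/submod_closedP.
have [z0 [Zz0 Bz0]] : exists z, Z z /\ ~ B z.
  apply: contrapT => no; apply: nZB => z Zz; apply: contrapT => ?.
  by apply: no; exists z.
have [s ms] := local_fg.
have [z [Zz Bz sz]] : exists z, [/\ Z z, ~ B z & forall a, a \in s -> B (a *: z)].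
  have : {subset s <= [pred a | `[< m a >]]}.
    by move=> a sa; apply/asboolP; rewrite ms; exact: ideal_gen_sub.
  elim: s {ms} => [|a s IHs] sm; first by exists z0.
  have [|z [Zz Bz sz]] := IHs; first by move=> b sb; apply: sm; rewrite inE sb orbT.
  have /nil [e0 e0P] : m a by apply/asboolP/sm; rewrite inE eqxx.
  have exB : exists e, `[< B (a ^+ e *: z) >] by exists e0; apply/asboolP/e0P.
  have [[|e] /asboolP Be emin] := ex_minnP exB.
    by rewrite scale1r in Be.
  exists (a ^+ e *: z); split; first exact: submodZ.
    by move=> /asboolP /emin; rewrite ltnn.
  move=> b; rewrite inE => /predU1P [->|sb]; first by rewrite scalerA -exprS.
  by rewrite scalerA mulrC -scalerA; apply: submodZ => //; apply: sz.
have mz a : m a -> B (a *: z).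
  rewrite ms => /ideal_gen_seqP [c ->]; rewrite scaler_suml.
  apply: submod_sum => // i; rewrite -scalerA; apply: submodZ => //.
  by apply: sz; apply: mem_nth.
pose C := [set w | exists c v, B v /\ w = c *: z + v].
have BC : B `<=` C by move=> v Bv; exists 0, v; rewrite scale0r add0r.
have Cz : C z by exists 1, 0; rewrite scale1r addr0; split=> //; exact: subB.1.
have subC : submodule C.
  split=> [|b _ _ [c [v [Fv ->]]] [d [u [Fu ->]]]].
    by apply: BC; exact: subB.1.
  exists (b * c + d), (b *: v + u); split; first exact: subB.2.
  by rewrite scalerDr scalerDl -[(b * c) *: _]scalerA addrACA.
have [|||k [F [F0 Fk Fsub FS]]] := IH C subC.
- by split=> // CB; apply: Bz; apply: CB.
- by move=> _ [c [v [Bv ->]]]; apply: subZ.2 => //; apply: BZ.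
- by move=> a /nil [e eP]; exists e => y /eP; apply: BC.
exists k.+1, (fun i => if i is j.+1 then F j else B); split=> //.
  by move=> [|j] jk; [apply/submod_closedP | apply: Fsub].
move=> [|j] jk; last exact: FS.
rewrite F0; split; first by split=> // CB; apply: Bz; apply: CB.
move=> W /submod_closedP subW BW WC.
have [[c [v [Bv [Ww mc]]]]|no] :=
  pselect (exists c v, B v /\ W (c *: z + v) /\ ~ m c).
  right; apply/seteqP; split=> // _ [d [u [Bu ->]]].
  have [e ce] := local_unit A_local mc.
  apply: subW.2; last exact: BW.
  rewrite -[z]scale1r -ce mulrC -scalerA; apply: submodZ => //.
  by rewrite -[_ *: z](addrK v); apply: submodB => //; apply: BW.
left; apply/seteqP; split=> // w Ww; have [c [v [Bv wE]]] := WC w Ww.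
rewrite wE; apply: submodD => //; apply: mz.
by apply: contrapT => mc; apply: no; exists c, v; rewrite -wE.
Qed.

End FiniteLength.

(** * Chain maps up to homotopy *)

Lemma int_succ_ind (P : int -> Prop) : (forall t, P (t + 1)) -> forall t, P t.
Proof. by move=> PS t; rewrite -(subrK 1 t). Qed.

(** Components of homotopies give families indexed by the degrees [t + 1]. Here
    they become families indexed by all degrees, and the cast along
    [t - 1 + 1 = t] stays inside the proof. *)
Lemma int_succ_family (T : int -> Type) (s : forall t, T (t + 1)) :
  exists f : forall t, T t, forall t, f (t + 1) = s t.
Proof.
exists (fun t => eq_rect (t - 1 + 1) T (s (t - 1)) t (subrK 1 t)) => t.
by move: (subrK 1 (t + 1)); rewrite (addrK 1 t) => e; rewrite eq_axiomK.
Qed.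

Lemma thin_mx (R : Type) m n (M N : 'M[R]_(m, n)) : m = 0%N -> M = N.
Proof. by move=> m0; apply/matrixP; move: m0 M N => -> M N []. Qed.

Section Complexes.
Variable A : comNzRingType.
Implicit Types X Y Z W N : bcomplex A.

Definition null X Y (f : chmap X Y) : Prop := homotopic f (ch_zero X Y).

Definition all_null X Y : Prop := forall f : chmap X Y, null f.

Lemma nullP X Y (f : chmap X Y) : null f <->
  exists s : forall i, 'M[A]_(rk X (i + 1), rk Y i),
    forall i, f (i + 1) = diff X (i + 1) *m s (i + 1) + s i *m diff Y i.
Proof. by split=> -[s sP]; exists s => i; move: (sP i); rewrite /= subr0. Qed.

Lemma null_comp_r X Y Z (g : chmap Y Z) (f : chmap X Y) :
  null f -> null (ch_comp g f).
Proof.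
move=> /nullP [s sP]; apply/nullP; exists (fun i => s i *m g i) => i /=.
by rewrite sP mulmxDl -!mulmxA chmap_comm.
Qed.

Lemma null_comp_l X Y Z (g : chmap Y Z) (f : chmap X Y) :
  null g -> null (ch_comp g f).
Proof.
move=> /nullP [s sP]; apply/nullP; exists (fun i => f (i + 1) *m s i) => i /=.
by rewrite sP mulmxDr !mulmxA chmap_comm.
Qed.

Lemma null_homotopic X Y (f g : chmap X Y) : homotopic f g -> null g -> null f.
Proof.
move=> [s sP] /nullP [r rP]; apply/nullP; exists (fun i => s i + r i) => i.
rewrite -(subrK (g (i + 1)) (f (i + 1))) sP rP mulmxDr mulmxDl.
exact: addrACA.
Qed.

Lemma homotopic_sym X Y (f g : chmap X Y) : homotopic f g -> homotopic g f.
Proof.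
move=> [s sP]; exists (fun i => - s i) => i.
by rewrite mulmxN mulNmx -opprD -sP opprB.
Qed.

Lemma homotopic_trans X Y (f g h : chmap X Y) :
  homotopic f g -> homotopic g h -> homotopic f h.
Proof.
move=> [s sP] [r rP]; exists (fun i => s i + r i) => i.
by rewrite -(subrKA (g (i + 1))) sP rP mulmxDr mulmxDl; exact: addrACA.
Qed.

Lemma homotopic_comp_l X Y Z (g g' : chmap Y Z) (f : chmap X Y) :
  homotopic g g' -> homotopic (ch_comp g f) (ch_comp g' f).
Proof.
move=> [s sP]; exists (fun i => f (i + 1) *m s i) => i /=.
by rewrite -mulmxBr sP mulmxDr !mulmxA chmap_comm.
Qed.

Lemma homotopic_eq X Y (f g : chmap X Y) :
  (forall i, f i = g i) -> homotopic f g.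
Proof.
by move=> fg; exists (fun=> 0) => i; rewrite fg subrr mulmx0 mul0mx addr0.
Qed.

Lemma null_retract X Y X' (a : chmap X Y) (b : chmap Y X) (f : chmap X' X) :
  homotopic (ch_comp b a) (ch_id X) -> null (ch_comp a f) -> null f.
Proof.
move=> ba af; apply: (@null_homotopic _ _ _ (ch_comp (ch_comp b a) f)).
  apply: homotopic_sym; apply: homotopic_trans (homotopic_comp_l f ba) _.
  by apply: homotopic_eq => i; rewrite /= mulmx1.
apply: null_homotopic (null_comp_r b af).
by apply: homotopic_eq => i; rewrite /= !mulmxA.
Qed.

Lemma is_zero_all_null X Y : is_zero X -> all_null Y X.
Proof.
move=> X0 f; apply: null_homotopic (null_comp_l f X0).
by apply: homotopic_eq => i; rewrite /= mulmx1.
Qed.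

(** * Direct sums *)

Lemma dsum_fst_subproof X Y i :
  (col_mx 1%:M 0 : 'M_(rk X i + rk Y i, _)) *m diff X i =
  diff (dsum X Y) i *m col_mx 1%:M 0.
Proof.
by rewrite /= mul_block_col mul_col_mx !mul1mx !mul0mx !mulmx0 mulmx1 !addr0.
Qed.
Definition dsum_fst X Y : chmap (dsum X Y) X :=
  @ChMap A (dsum X Y) X (fun i => col_mx 1%:M 0) (dsum_fst_subproof X Y).

Lemma dsum_snd_subproof X Y i :
  (col_mx 0 1%:M : 'M_(rk X i + rk Y i, _)) *m diff Y i =
  diff (dsum X Y) i *m col_mx 0 1%:M.
Proof.
by rewrite /= mul_block_col mul_col_mx !mul1mx !mul0mx !mulmx0 mulmx1 !add0r.
Qed.
Definition dsum_snd X Y : chmap (dsum X Y) Y :=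
  @ChMap A (dsum X Y) Y (fun i => col_mx 0 1%:M) (dsum_snd_subproof X Y).

Lemma null_dsum X Y Z (f : chmap Z (dsum X Y)) :
  null (ch_comp (dsum_fst X Y) f) -> null (ch_comp (dsum_snd X Y) f) -> null f.
Proof.
move=> /nullP [s sP] /nullP [r rP]; apply/nullP.
exists (fun i => row_mx (s i) (r i)) => i /=.
rewrite mul_mx_row mul_row_block !mulmx0 addr0 add0r add_row_mx -sP -rP /=.
have f1 : lsubmx (f (i + 1)) =
    f (i + 1) *m (col_mx 1%:M 0 : 'M_(rk X (i + 1) + rk Y (i + 1), _)).
  by rewrite -{2}[f (i + 1)]hsubmxK mul_row_col mulmx1 mulmx0 addr0.
have f2 : rsubmx (f (i + 1)) =
    f (i + 1) *m (col_mx 0 1%:M : 'M_(rk X (i + 1) + rk Y (i + 1), _)).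
  by rewrite -{2}[f (i + 1)]hsubmxK mul_row_col mulmx1 mulmx0 add0r.
by rewrite -f1 -f2 hsubmxK.
Qed.

(** * Maps to and from cones *)

(** The exact sequence [Hom(Z, X) -> Hom(Z, Y) -> Hom(Z, cone u)]. A homotopy to
    zero has two components: the one in [shift X] is a chain map to [X], the
    one in [Y] a homotopy from [f] to its composite with [u]. *)
Lemma cone_in_null X Y Z (u : chmap X Y) (f : chmap Z Y) :
  null (ch_comp (cone_in u) f) ->
  exists g : chmap Z X, homotopic f (ch_comp u g).
Proof.
move=> /nullP [s sP].
pose si i : 'M_(rk Z (i + 1), rk X (i + 1)) :=
  @lsubmx _ _ (rk X (i + 1)) (rk Y i) (s i).
pose ta i : 'M_(rk Z (i + 1), rk Y i) :=
  @rsubmx _ _ (rk X (i + 1)) (rk Y i) (s i).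
have sE i : s i = row_mx (si i) (ta i) by rewrite hsubmxK.
have {}sP i : 0 = diff Z (i + 1) *m si (i + 1) - si i *m diff X (i + 1) /\
    f (i + 1) = diff Z (i + 1) *m ta (i + 1) +
      (si i *m u (i + 1) + ta i *m diff Y i).
  move: (sP i); rewrite /= /cone_diff !sE mul_mx_row mul_row_block mul_mx_row.
  by rewrite !mulmx0 !mulmx1 addr0 mulmxN add_row_mx => /eq_row_mx.
have [g gP] := @int_succ_family (fun i => 'M_(rk Z i, rk X i)) si.
have g_comm i : g i *m diff X i = diff Z i *m g (i + 1).
  move: i; apply: int_succ_ind => i; have [/eqP + _] := sP i.
  by rewrite eq_sym subr_eq0 !gP => /eqP ->.
exists (ChMap g_comm), ta => i /=.
have [_ ->] := sP i; rewrite gP [si i *m _ + _]addrC addrA addrK //.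
Qed.

(** The exact sequence [Hom(Y', X) -> Hom(Y, X) -> Hom(cone u, shift X)], by the
    same reading of the two components of a homotopy to zero. *)
Lemma cone_out_null X Y Y' (u : chmap Y Y') (f : chmap Y X) :
  null (ch_comp (shift_map f) (cone_out u)) ->
  exists g : chmap Y' X, homotopic f (ch_comp g u).
Proof.
move=> /nullP [s sP].
pose si i : 'M_(rk Y (i + 1 + 1), rk X (i + 1)) :=
  @usubmx _ (rk Y (i + 1 + 1)) (rk Y' (i + 1)) _ (s i).
pose ta i : 'M_(rk Y' (i + 1), rk X (i + 1)) :=
  @dsubmx _ (rk Y (i + 1 + 1)) (rk Y' (i + 1)) _ (s i).
have sE i : s i = col_mx (si i) (ta i) by rewrite vsubmxK.
have {}sP i : f (i + 1 + 1) = - (diff Y (i + 1 + 1) *m si (i + 1)) +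
      u (i + 1 + 1) *m ta (i + 1) - si i *m diff X (i + 1) /\
    0 = diff Y' (i + 1) *m ta (i + 1) - ta i *m diff X (i + 1).
  move: (sP i); rewrite /= /cone_diff !sE mul_col_mx mul_block_col mul_col_mx.
  by rewrite !mul0mx !mul1mx add0r !mulmxN mulNmx add_col_mx => /eq_col_mx.
have [g gP] := @int_succ_family (fun i => 'M_(rk Y' i, rk X i)) ta.
have g_comm i : g i *m diff X i = diff Y' i *m g (i + 1).
  move: i; apply: int_succ_ind => i; have [_ /eqP] := sP i.
  by rewrite eq_sym subr_eq0 !gP => /eqP ->.
have [h hP] :=
  @int_succ_family (fun i => 'M_(rk Y (i + 1), rk X i)) (fun i => - si i).
exists (ChMap g_comm), h; apply: int_succ_ind => i /=.
have [-> _] := sP i; rewrite gP !hP mulmxN mulNmx.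
by rewrite [LHS]addrAC addrK.
Qed.

(** * Exactness in a range of degrees *)

(** Degrees of the form [t + 1] avoid a cast between the two differentials. *)
Definition exact_at X (t : int) : Prop :=
  forall z : 'rV[A]_(rk X (t + 1)), z *m diff X (t + 1) = 0 ->
    exists y, z = y *m diff X t.

Lemma exact_atP X t : exact_at X t ->
  forall n (M : 'M[A]_(n, rk X (t + 1))), M *m diff X (t + 1) = 0 ->
  exists L, M = L *m diff X t.
Proof.
move=> ex n M MX.
have /choice [y yP] (i : 'I_n) : exists y, row i M = y *m diff X t.
  by apply: ex; rewrite -row_mul MX row0.
by exists (\matrix_i y i); apply/row_matrixP => i; rewrite row_mul rowK.
Qed.

(** The complexes that matter have cohomology only far away from degree [0], on
    either side: truncated free resolutions, shifted. *)
Definition exact_near0 X (c : nat) : Prop :=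
  forall t : int, (`|t| <= c)%N -> exact_at X t.

Lemma exact_near0W X c c' : (c <= c')%N -> exact_near0 X c' -> exact_near0 X c.
Proof. by move=> cc' ex t tc; apply: ex; lia. Qed.

(** If [X] is exact in the degrees where [W] lives, a homotopy from a map
    [W -> X] to zero is built from the top degree of [W] downwards: in each
    degree freeness of [W] solves the homotopy equation. *)
Lemma exact_all_null W : exists b, forall X, exact_near0 X b -> all_null W X.
Proof.
have [b Wb] := rk_bounded W; exists b.+1 => X ex f; apply/nullP.
(* The first of the two equations in degree [t] is what the choice of the next
   component, in degree [t - 1], requires. *)
have ind : forall n : nat, (n <= b.*2.+1)%N ->
  exists s : forall i, 'M[A]_(rk W (i + 1), rk X i),
    forall t : int, (b%:Z - n%:Z <= t) ->
      diff W t *m f (t + 1) = diff W t *m (s t *m diff X t) /\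
      f (t + 1) = diff W (t + 1) *m s (t + 1) + s t *m diff X t.
  elim=> [|n IHn] nb.
    exists (fun=> 0) => t bt; have W0 : rk W (t + 1) = 0%N by apply: Wb; lia.
    by rewrite (thin_mx (f (t + 1)) 0 W0) !mulmx0 mul0mx mulmx0 add0r.
  have [|s sP] := IHn; first exact: ltnW.
  pose t0 : int := b%:Z - n.+1%:Z.
  have ext0 : exact_at X t0 by apply: ex; rewrite /t0; lia.
  have [|S SP] := exact_atP ext0 (M := f (t0 + 1) - diff W (t0 + 1) *m s (t0 + 1)).
    have [|I0 _] := sP (t0 + 1); first by rewrite /t0; lia.
    by rewrite mulmxBl chmap_comm I0 mulmxA subrr.
  exists (dfwith s S) => t bt.
  have t1 : dfwith s S (t + 1) = s (t + 1).
    by rewrite dfwith_out //; apply/eqP; rewrite /t0; lia.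
  rewrite t1; have [e|/eqP tt0] := t =P t0.
    rewrite e dfwith_in -SP; split; last by rewrite [RHS]addrC subrK.
    by rewrite mulmxBr mulmxA diff_diff mul0mx subr0.
  by rewrite dfwith_out 1?eq_sym //; apply: sP; move/eqP: tt0; rewrite /t0; lia.
have [s sP] := ind _ (leqnn _); exists s => t.
have [bt|bt] := leP (b%:Z - (b.*2.+1)%:Z) t; first by have [] := sP t bt.
by apply: thin_mx; apply: Wb; lia.
Qed.

Lemma cone_exact X Y (u : chmap X Y) c :
  exact_near0 X c.+1 -> exact_near0 Y c.+1 -> exact_near0 (cone u) c.
Proof.
move=> exX exY t tc z.
rewrite -[z]hsubmxK /= /cone_diff; move: (lsubmx z) (rsubmx z) => x y.
rewrite mul_row_block mulmx0 addr0 -row_mx0 mulmxN => /eq_row_mx [/eqP].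
rewrite oppr_eq0 => /eqP xd yd.
have [|x' xE] := exX (t + 1) _ x xd; first by lia.
have [||y' yE] := exY t _ (y + x' *m u (t + 1)); first by lia.
  by rewrite mulmxDl -mulmxA chmap_comm mulmxA -xE [LHS]addrC.
exists (row_mx (- x') y').
rewrite mul_row_block mulmx0 addr0 mulNmx mulmxN opprK -xE mulNmx -yE.
by rewrite [- _ + _]addrC addrK.
Qed.

End Complexes.

(** * Decomposition into indecomposables *)

Section Decomposition.
Variables (A : comNzRingType) (m : set A).
Hypothesis A_local : local_ring m.

Section Residue.
Variables (k : fieldType) (p : {rmorphism A -> k}).
Hypotheses (p_surj : forall y, exists x, p x = y)
  (p_ker : forall x, p x = 0 <-> m x).
Local Notation bar := (map_mx p).

(** The cohomology of [X] over the residue field has dimension at least [r] in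
    degree [i + 1]: the columns of [v] are functionals on cohomology, dual to
    the classes of the rows of [u]. In this form the behaviour under homotopy
    equivalences and direct sums is immediate. *)
Definition betti_ge (X : bcomplex A) (i : int) (r : nat) : Prop :=
  exists (u : 'M[k]_(r, rk X (i + 1))) (v : 'M[k]_(rk X (i + 1), r)),
    [/\ u *m bar (diff X (i + 1)) = 0, bar (diff X i) *m v = 0 & u *m v = 1%:M].

Lemma betti_ge0 X i : betti_ge X i 0.
Proof. by exists 0, 0; split; rewrite ?mulmx0 ?mul0mx //; apply: thin_mx. Qed.

Lemma betti_ge_rk X i r : betti_ge X i r -> (r <= rk X (i + 1))%N.
Proof. by case=> u [v [_ _ /mulmx1_min]]. Qed.

Lemma betti_ge_retract X Y (f : chmap X Y) (g : chmap Y X) i r :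
  homotopic (ch_comp g f) (ch_id X) -> betti_ge X i r -> betti_ge Y i r.
Proof.
case=> s sP [u [v [ud dv uv]]].
exists (u *m bar (f (i + 1))), (bar (g (i + 1)) *m v); split.
- by rewrite -mulmxA -map_mxM chmap_comm map_mxM mulmxA ud mul0mx.
- by rewrite mulmxA -map_mxM -chmap_comm map_mxM -mulmxA dv mulmx0.
have /eqP := sP i; rewrite /= subr_eq => /eqP fg.
rewrite mulmxA -(mulmxA u) -map_mxM fg !map_mxD map_mx1 !map_mxM.
by rewrite !mulmxDr mulmx1 !mulmxDl mulmxA ud -!mulmxA dv !(mul0mx, mulmx0) !add0r.
Qed.

Lemma betti_ge_dsum X Y i r r' :
  betti_ge X i r -> betti_ge Y i r' -> betti_ge (dsum X Y) i (r + r').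
Proof.
move=> [u [v [ud dv uv]]] [u' [v' [ud' dv' uv']]].
exists (block_mx u 0 0 u'), (block_mx v 0 0 v'); split;
  rewrite /= ?map_block_mx ?map_mx0 mulmx_block !(mul0mx, mulmx0, addr0, add0r).
- by rewrite ud ud' block_mx_const.
- by rewrite dv dv' block_mx_const.
- by rewrite uv uv' scalar_mx_block.
Qed.

Lemma lift_invertible n (M : 'M[A]_n) : bar M = 1%:M ->
  exists L, M *m L = 1%:M /\ L *m M = 1%:M.
Proof.
move=> M1; have [|c cP] := local_unit A_local (a := \det M).
  by move/p_ker; rewrite -det_map_mx M1 det1 => /eqP; rewrite oner_eq0.
exists (c *: \adj M); split.
  by rewrite -scalemxAr mul_mx_adj scale_scalar_mx mulrC cP.
by rewrite -scalemxAl mul_adj_mx scale_scalar_mx mulrC cP.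
Qed.

(** If the reduction of [X] to the residue field is exact, a contracting homotopy
    of it lifts to a homotopy from an endomorphism of [X] to zero. The
    determinants of this endomorphism reduce to [1], so they are units, and the
    zero map is homotopic to an automorphism of [X]. *)
Lemma betti_nonzero X : ~ is_zero X -> exists i, betti_ge X i 1.
Proof.
move=> nX0; apply: contrapT => nob; apply: nX0.
pose d i := bar (diff X i).
have ex i : (kermx (d (i + 1)%R) <= d i)%MS.
  apply/row_subP => l; apply: contrapT => nle; apply: nob; exists i.
  have ud : row l (kermx (d (i + 1))) *m d (i + 1) = 0.
    by rewrite -row_mul mulmx_ker row0.
  move: (row l _) nle ud => u; rewrite submxE => nz ud.
  have [j nzj] : exists j, (u *m cokermx (d i)) 0 j != 0.
    apply: contrapT => all0; apply: nz; apply/eqP/rowP => j; rewrite [RHS]mxE.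
    by apply: contrapT => /eqP nzj; apply: all0; exists j.
  have := mulmx_coker (d i); move: (cokermx (d i)) nzj => C nzj dC.
  exists u, (((u *m C) 0 j)^-1 *: col j C).
  rewrite -!scalemxAr colE !mulmxA dC mul0mx scaler0 -colE.
  split=> //; apply/matrixP => a b; rewrite !ord1 [LHS]mxE [X in _ * X]mxE.
  by rewrite mulVf // mxE.
(* [e i] projects onto the kernel of [d (i + 1)], which is the image of [d i]. *)
pose e i := 1%:M - d (i + 1) *m pinvmx (d (i + 1)).
have eK i : e i *m pinvmx (d i) *m d i = e i.
  apply: mulmxKpV; apply: submx_trans (ex i); apply/sub_kermxP.
  by rewrite mulmxBl mul1mx mulmxKpV // subrr.
have [sg sgK] := choice p_surj.
pose S i := map_mx sg (e i *m pinvmx (d i)).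
have SP i : bar (S i) = e i *m pinvmx (d i).
  by apply/matrixP => a b; rewrite !mxE sgK.
pose U i := diff X (i + 1) *m S (i + 1) + S i *m diff X i.
have U1 i : bar (U i) = 1%:M.
  rewrite map_mxD !map_mxM !SP -!/(d _) eK mulmxA.
  have -> : d (i + 1) *m e (i + 1) = d (i + 1).
    by rewrite mulmxBr mulmx1 mulmxA -map_mxM diff_diff map_mx0 mul0mx subr0.
  by rewrite [LHS]addrC subrK.
pose V i := sval (cid (lift_invertible (U1 i))).
have VP i : U i *m V i = 1%:M /\ V i *m U i = 1%:M :=
  svalP (cid (lift_invertible (U1 i))).
have Vd i : V i *m diff X (i + 1) = diff X (i + 1) *m V (i + 1).
  have dU : U i *m diff X (i + 1) = diff X (i + 1) *m U (i + 1).
    rewrite mulmxDl mulmxDr -!mulmxA diff_diff mulmx0 addr0.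
    by rewrite !mulmxA diff_diff mul0mx add0r.
  have [_ VU] := VP i; have [UV _] := VP (i + 1).
  by rewrite -[LHS]mulmx1 -UV mulmxA -(mulmxA (V i)) -dU !mulmxA VU mul1mx.
exists (fun i => V i *m S i) => i /=.
by rewrite subr0 mulmxA -Vd -!mulmxA -mulmxDr; have [_ ->] := VP i.
Qed.

End Residue.

(** Splitting off nonzero summands terminates: the total dimension of the
    cohomology over the residue field drops. *)
Lemma kbf_ind (Q : kbf A -> Prop) :
  (forall X : kbf A, is_zero X -> Q X) ->
  (forall X : kbf A, indecomposable X -> Q X) ->
  (forall X Y Z : kbf A, isomorphic X (dsum Y Z) -> Q Y -> Q Z -> Q X) ->
  forall X, Q X.
Proof.
move=> Q0 Qind Qsum X.
have [k [p [p_surj p_ker]]] := residue_field A_local.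
pose beta := betti_ge p.
have [b0 X_b0] := rk_bounded X; pose b := b0.+1.
(* One range of degrees serves all the summands of [X], whatever bounds come
   with them, because their cohomology vanishes outside it. *)
pose tot (r : int -> nat) := (\sum_(j < b.*2.+1) r (j%:Z - b%:Z)%R)%N.
have ind N : forall Y : kbf A,
    (forall i r, (b < `|i|)%N -> beta Y i r -> r = 0%N) ->
    (forall r, (forall i, beta Y i (r i)) -> (tot r < N)%N) -> Q Y.
  elim: N => [|N IHN] Y Yb Ytot.
    by have := Ytot (fun=> 0%N) (fun i => betti_ge0 p Y i).
  have [Y0|nY0] := pselect (is_zero Y); first exact: Q0.
  have [indY|nindY] := pselect (indecomposable Y); first exact: Qind.
  have [Z [T [YZT nZ nT]]] : exists Z T : kbf A,
      [/\ isomorphic Y (dsum Z T), ~ is_zero Z & ~ is_zero T].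
    apply: contrapT => no; apply: nindY; split=> // Z T YZT.
    have [|nZ] := pselect (is_zero Z); first by left.
    have [|nT] := pselect (is_zero T); first by right.
    by case: no; exists Z, T.
  have [f [g [_ fg]]] := YZT.
  have add i r r' : beta Z i r -> beta T i r' -> beta Y i (r + r')%N.
    by move=> /betti_ge_dsum H /H; exact: betti_ge_retract fg.
  have summand (Z' T' : kbf A) :
      (forall i r r', beta Z' i r -> beta T' i r' -> beta Y i (r + r')%N) ->
      ~ is_zero T' -> Q Z'.
    move=> addZT nT'; apply: IHN => [i r bi Zr|r Zr].
      have := addZT i r 0%N Zr (betti_ge0 _ _ _); rewrite addn0; exact: Yb.
    have [i0 T'i0] := betti_nonzero p_surj p_ker nT'.
    have bi0 : (`|i0| <= b)%N.
      rewrite leqNgt; apply/negP => /Yb /(_ (addZT _ _ _ (betti_ge0 _ _ _) T'i0)).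
      by [].
    have := Ytot (fun i => r i + (i == i0))%N; rewrite /tot big_split /=.
    have ltj : (absz (i0 + b%:Z)%R < b.*2.+1)%N by lia.
    have -> : (\sum_(j < b.*2.+1) (j%:Z - b%:Z == i0)%R = 1)%N.
      rewrite (bigD1 (Ordinal ltj)) //= big1 => [|j /eqP jN].
        by rewrite (_ : _ == _ = true) //; apply/eqP; lia.
      apply/eqP; rewrite eqb0; apply/eqP => ji; apply: jN; apply: val_inj => /=.
      by lia.
    rewrite addn1 ltnS; apply => i; apply: addZT => //.
    by have [->|_] := eqVneq i i0; last exact: betti_ge0.
  apply: (Qsum Y Z T YZT).
    exact: summand nT.
  by apply: (summand T Z) => // i r r' Tr Zr; rewrite addnC; exact: add.
apply: (ind (\sum_(j < b.*2.+1) rk X (j%:Z - b%:Z + 1)%R).+1)%N.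
  move=> i r bi /betti_ge_rk; rewrite X_b0 ?leqn0 => [/eqP //|].
  by rewrite /b in bi; lia.
by move=> r rP; rewrite ltnS; apply: leq_sum => j _; apply: betti_ge_rk (rP _).
Qed.

End Decomposition.

(** * Consequences of AR-triangles *)

Section AuslanderReiten.
Variables (A : comNzRingType) (m : set A).
Hypotheses (A_local : local_ring m) (A_noeth : noetherian A).

(** Finite length in the form that cones inherit. *)
Definition nilpotent_cohomology (X : bcomplex A) : Prop :=
  forall a, m a -> forall i, exists n, forall z : 'rV_(rk X (i + 1)),
    z *m diff X (i + 1) = 0 ->
    exists y, a ^+ n *: z = y *m diff X i.

Lemma finite_length_cohomologyP X :
  finite_length_cohomology X <-> nilpotent_cohomology X.
Proof.
split=> [fl a ma i|nil i].
  have [n nP] := finite_length_nilpotent A_local (fl i) ma.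
  by exists n => z /nP [y _ <-]; exists y.
apply: (nilpotent_finite_length A_local A_noeth).
- split=> [|a x y /= xd yd]; first exact: mul0mx.
  by rewrite mulmxDl -scalemxAl xd yd scaler0 addr0.
- split=> [|a _ _ [x _ <-] [y _ <-]]; first by exists 0; rewrite ?mul0mx.
  by exists (a *: x + y); rewrite // mulmxDl scalemxAl.
- by move=> _ [y _ <-] /=; rewrite -mulmxA diff_diff mulmx0.
- move=> a ma; have [n nP] := nil a ma i.
  by exists n => z /nP [y ->]; exists y.
Qed.

Lemma cone_nilpotent X Y (u : chmap X Y) :
  nilpotent_cohomology X -> nilpotent_cohomology Y ->
  nilpotent_cohomology (cone u).
Proof.
move=> nX nY a ma i.
have [n nP] := nX a ma (i + 1); have [l lP] := nY a ma i.
exists (l + n)%N => z; rewrite -[z]hsubmxK /= /cone_diff.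
move: (lsubmx z) (rsubmx z) => x y.
rewrite mul_row_block mulmx0 addr0 -row_mx0 mulmxN => /eq_row_mx [/eqP].
rewrite oppr_eq0 => /eqP xd yd.
have [x' xE] := nP x xd.
have [|y' yE] := lP (a ^+ n *: y + x' *m u (i + 1)).
  rewrite mulmxDl -mulmxA chmap_comm mulmxA -xE -!scalemxAl -scalerDr.
  by rewrite [_ + x *m _]addrC yd scaler0.
exists (row_mx (- (a ^+ l *: x')) y').
rewrite mul_row_block mulmx0 addr0 mulNmx mulmxN opprK -yE mulNmx -!scalemxAl -xE.
by rewrite scalerDr [- _ + _]addrC addrK !scalerA -exprD scale_row_mx.
Qed.

Definition kbf_cone (X Y : kbf A) (u : chmap X Y) : kbf A :=
  Kbf ((finite_length_cohomologyP (cone u)).2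
    (cone_nilpotent u ((finite_length_cohomologyP X).1 (kbf_finite_length X))
                      ((finite_length_cohomologyP Y).1 (kbf_finite_length Y)))).

Hypothesis A_AR : has_AR_triangles A.

(** [W] is the source of the map [w] of a left AR-triangle starting at [N]. If
    [u : Y -> N] is not null-homotopic, then [N -> cone u] is not a split
    monomorphism, hence kills [w], and [w] factors through [u]; so the factor
    [W -> Y] is not null-homotopic. *)
Lemma left_AR_all_null (N : kbf A) : indecomposable N ->
  exists W : bcomplex A, forall Y : kbf A, all_null W Y -> all_null Y N.
Proof.
move=> /A_AR [_ [E [L [w [f [g [_ _ wn0 AR]]]]]]].
(* The defining property of AR-triangles concerns indecomposable [D]; it
   passes to direct sums. *)
have split_or_kill : forall (D : kbf A) (s : chmap N D),
    (exists r, homotopic (ch_comp r s) (ch_id N)) \/ null (ch_comp s w).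
  apply: (kbf_ind A_local) => [D D0 s|D indD s|D Y Z [i [j [ji ij]]] QY QZ s].
  - by right; apply: is_zero_all_null.
  - have [[r [rs _]]|niso] := pselect (ch_iso s); first by left; exists r.
    by right; exact: AR.
  - have assoc (T : bcomplex A) (q : chmap (dsum Y Z) T) (r : chmap T N) :
        homotopic (ch_comp r (ch_comp q (ch_comp i s))) (ch_id N) ->
        exists r, homotopic (ch_comp r s) (ch_id N).
      exists (ch_comp r (ch_comp q i)); apply: homotopic_trans H.
      by apply: homotopic_eq => t; rewrite /= !mulmxA.
    have [[r /assoc]|Yw] := QY (ch_comp (dsum_fst Y Z) (ch_comp i s)).
      by left.
    have [[r /assoc]|Zw] := QZ (ch_comp (dsum_snd Y Z) (ch_comp i s)).
      by left.
    right; apply: (null_retract ji); apply: null_dsum.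
      apply: null_homotopic Yw; apply: homotopic_eq => t; by rewrite /= !mulmxA.
    by apply: null_homotopic Zw; apply: homotopic_eq => t; rewrite /= !mulmxA.
exists (unshift L) => Y WY u; apply: contrapT => un0.
have [[r rs]|/cone_in_null [v wuv]] := split_or_kill (kbf_cone u) (cone_in u).
  apply: un0; apply: (null_retract rs); apply/nullP.
  exists (fun i => row_mx 1%:M 0) => i /=.
  rewrite /cone_diff mul_row_block !mul1mx !mul0mx !addr0 mul_mx_row mulmx1 mulmx0.
  by rewrite mul_mx_row mulmx0 mulmx1 add_row_mx subrr add0r.
by apply: wn0; apply: null_homotopic wuv _; apply: null_comp_r; exact: WY.
Qed.

(** For indecomposable [X] the bound is that of the bounded complex [W] above,
    which has no nonzero maps to complexes that are exact where it lives. *)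
Lemma AR_exact_all_null (X : kbf A) :
  exists c, forall Y : kbf A, exact_near0 Y c -> all_null Y X.
Proof.
move: X; apply: (kbf_ind A_local).
1: move=> X X0.
2: move=> X indX.
3: move=> X Y Z [i [j [ji ij]]] [c cP] [d dP].
- by exists 0%N => Y _; apply: is_zero_all_null.
- have [W WP] := left_AR_all_null indX; have [b bP] := exact_all_null W.
  by exists b => Y exY; apply: WP; apply: bP.
- exists (maxn c d) => T exT f; apply: (null_retract ji); apply: null_dsum.
    by apply: cP; apply: exact_near0W exT; exact: leq_maxl.
  by apply: dP; apply: exact_near0W exT; exact: leq_maxr.
Qed.

(** * Koszul complexes *)

Lemma homothety_subproof a (X : bcomplex A) i :
  a%:M *m diff X i = diff X i *m a%:M.
Proof. by rewrite mul_scalar_mx mul_mx_scalar. Qed.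

Definition homothety a (X : bcomplex A) : chmap X X :=
  ChMap (homothety_subproof a X).

Definition koszul (s : seq A) (X : bcomplex A) : bcomplex A :=
  foldr (fun a Y => cone (homothety a Y)) X s.

Lemma koszul_exact s X c : exact_near0 X (c + size s) -> exact_near0 (koszul s X) c.
Proof.
elim: s c => [|a s IHs] c; first by rewrite addn0.
by rewrite addnS -addSn => /IHs exX; apply: cone_exact.
Qed.

(** A homotopy for [b] on [X] acts diagonally on the cone, with the sign of the
    shift; it commutes with the scalar [a]. *)
Lemma null_homothety_cone a b (X : bcomplex A) :
  null (homothety b X) -> null (homothety b (cone (homothety a X))).
Proof.
move=> /nullP [s sP]; apply/nullP.
exists (fun i => block_mx (- s (i + 1)) 0 0 (s i)) => i /=.
rewrite /cone_diff !mulmx_block !(mulmx0, mul0mx, addr0, add0r) mulmxN mulNmx opprK.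
rewrite add_block_mx !(add0r, addr0) !mulNmx !mulmxN !opprK -!sP /=.
by rewrite mul_scalar_mx mul_mx_scalar subrr scalar_mx_block.
Qed.

Lemma null_homothety_cone_self a (X : bcomplex A) :
  null (homothety a (cone (homothety a X))).
Proof.
apply/nullP; exists (fun i => block_mx 0 0 1%:M 0) => i /=.
rewrite /cone_diff !mulmx_block !(mulmx0, mul0mx, addr0, add0r, mul1mx, mulmx1).
by rewrite add_block_mx !(add0r, addr0) addrN scalar_mx_block.
Qed.

Lemma null_homothety_ideal (X : bcomplex A) :
  @submodule A A^o [set a | null (homothety a X)].
Proof.
split=> [|a x y /nullP [r rP] /nullP [s sP]].
  by apply: homotopic_eq => i /=; exact: raddf0.
apply/nullP; exists (fun i => a *: r i + s i) => i.
rewrite mulmxDr mulmxDl -scalemxAr -scalemxAl addrACA -scalerDr -rP -sP /=.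
by rewrite scale_scalar_mx raddfD.
Qed.

Lemma koszul_null_homothety s X a :
  a \in s -> null (homothety a (koszul s X)).
Proof.
elim: s => //= b s IHs; rewrite inE => /predU1P [->|/IHs].
  exact: null_homothety_cone_self.
exact: null_homothety_cone.
Qed.

(** The elements acting as zero on the Koszul complex form an ideal containing
    the generators [s] of [m]; thus [m] annihilates its cohomology. *)
Lemma koszul_finite_length s X :
  m = ideal_gen [set` s] -> finite_length_cohomology (koszul s X).
Proof.
move=> ms; apply/finite_length_cohomologyP => a; rewrite ms => sa i.
have /nullP [r rP] : null (homothety a (koszul s X)).
  apply: (ideal_gen_min (null_homothety_ideal (koszul s X))) sa => b.
  exact: koszul_null_homothety.
exists 1%N => z zd; exists (z *m r i).
rewrite expr1 -mul_mx_scalar [a%:M]rP mulmxDr mulmxA zd mul0mx add0r mulmxA.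
by [].
Qed.

End AuslanderReiten.

(** * Completeness and vanishing of maps *)

Section Completeness.
Variables (A : comNzRingType) (m : set A).
Hypotheses (A_local : local_ring m) (A_complete : adic_complete m).

Lemma ideal_gen_submodule (S : set A) : @submodule A A^o (ideal_gen S).
Proof.
split=> [I [/idealP [] //]|a x y Sx Sy I [iI SI]].
by have /idealP [_] := iI; apply; [apply: Sx | apply: Sy].
Qed.

Lemma ideal_pow_submodule n : @submodule A A^o (ideal_pow m n).
Proof. by case: n => [|n]; [split | exact: ideal_gen_submodule]. Qed.

Lemma ideal_powM a n x : m a -> ideal_pow m n (a ^+ n * x).
Proof.
move=> ma; elim: n x => [|n IHn] x //=; rewrite exprS -mulrA.
by apply: ideal_gen_sub; exists a => //; exists (a ^+ n * x).
Qed.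

Definition adic_small n p q (M : 'M[A]_(p, q)) : Prop :=
  forall i j, ideal_pow m n (M i j).

Lemma adic_smallD n p q (M N : 'M[A]_(p, q)) :
  adic_small n M -> adic_small n N -> adic_small n (M + N).
Proof.
by move=> Mn Nn i j; rewrite mxE; apply: (submodD (ideal_pow_submodule n)).
Qed.

Lemma adic_small_mulmxr n p q r (M : 'M[A]_(p, q)) (N : 'M[A]_(q, r)) :
  adic_small n M -> adic_small n (M *m N).
Proof.
move=> Mn i j; rewrite mxE; apply: (submod_sum (ideal_pow_submodule n)) => l.
by rewrite mulrC; apply: (submodZ (ideal_pow_submodule n)).
Qed.

Lemma adic_small_mulmxl n p q r (M : 'M[A]_(p, q)) (N : 'M[A]_(q, r)) :
  adic_small n N -> adic_small n (M *m N).
Proof.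
move=> Nn i j; rewrite mxE; apply: (submod_sum (ideal_pow_submodule n)) => l.
exact: (submodZ (ideal_pow_submodule n)).
Qed.

Lemma adic_smallZ a n p q (M : 'M[A]_(p, q)) : m a -> adic_small n (a ^+ n *: M).
Proof. by move=> ma i j; rewrite mxE; exact: ideal_powM. Qed.

Lemma adic_small0 p q (M : 'M[A]_(p, q)) : (forall n, adic_small n M) -> M = 0.
Proof.
move=> Mn; apply/matrixP => i j; rewrite mxE.
have : (\bigcap_n ideal_pow m n) (M i j) by move=> n _; exact: Mn.
by rewrite A_complete.1.
Qed.

Lemma adic_series a p q (s : nat -> 'M[A]_(p, q)) : m a ->
  exists L, forall n, adic_small n (\sum_(k < n) a ^+ k *: s k - L).
Proof.
move=> ma; pose P n := \sum_(k < n) a ^+ k *: s k.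
have tail n l : (n <= l)%N -> adic_small n (P l - P n).
  elim: l => [|l IHl].
    by rewrite leqn0 => /eqP -> i j; rewrite subrr mxE; exact: (ideal_pow_submodule 0).1.
  rewrite leq_eqVlt => /predU1P [->|nl].
    by rewrite subrr => i j; rewrite mxE; exact: (ideal_pow_submodule _).1.
  rewrite {1}/P big_ord_recr /= -/(P l) addrAC; apply: adic_smallD; first exact: IHl.
  rewrite ltnS in nl; rewrite -(subnKC nl) exprD -scalerA; exact: adic_smallZ.
have lim i j : exists x, forall n, exists N, forall l, (N <= l)%N ->
    ideal_pow m n (P l i j - x).
  apply: A_complete.2 => n; exists n => l l' nl nl'.
  rewrite -(subrKA (P n i j)); apply: (submodD (ideal_pow_submodule n)).
    by have := tail n l nl i j; rewrite !mxE.
  rewrite -opprB; apply: (submodN (ideal_pow_submodule n)).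
  by have := tail n l' nl' i j; rewrite !mxE.
have /choice [x xP] (ij : 'I_p * 'I_q) := lim ij.1 ij.2.
exists (\matrix_(i, j) x (i, j)) => n i j; have [N NP] := xP (i, j) n.
pose l := maxn n N.
have -> : (P n - \matrix_(i, j) x (i, j)) i j =
    (P l i j - x (i, j)) - (P l - P n) i j.
  by rewrite !mxE opprB [RHS]addrC subrKA.
apply: (submodB (ideal_pow_submodule n)); first exact: NP (leq_maxr _ _).
exact: tail (leq_maxl _ _) i j.
Qed.

(** The form of Nakayama's lemma that applies to the module of homotopy classes
    of maps [Y -> X]: the homotopies witnessing that [f] is divisible by ever
    higher powers of [a] add up to a convergent series. *)
Lemma divisible_all_null a (Y X : bcomplex A) : m a ->
  (forall f : chmap Y X, exists g, homotopic f (ch_comp (homothety a X) g)) ->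
  all_null Y X.
Proof.
move=> ma div f.
have [nxt nxtP] := choice div.
pose g n := iter n nxt f.
pose s n := sval (cid (nxtP (g n))).
have sP n i : g n (i + 1) - a *: g n.+1 (i + 1) =
    diff Y (i + 1) *m s n (i + 1) + s n i *m diff X i.
  by have := svalP (cid (nxtP (g n))) i; rewrite /= mul_mx_scalar.
pose P n i := \sum_(k < n) a ^+ k *: s k i.
have PP n i : f (i + 1) = a ^+ n *: g n (i + 1) +
    (diff Y (i + 1) *m P n (i + 1) + P n i *m diff X i).
  elim: n => [|n IHn].
    by rewrite scale1r /P !big_ord0 mulmx0 mul0mx !addr0.
  rewrite {1}IHn -[g n (i + 1)](subrK (a *: g n.+1 (i + 1))) sP /P !big_ord_recr /=.
  rewrite mulmxDr mulmxDl -scalemxAr -scalemxAl [X in _ = _ + X]addrACA -scalerDr.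
  have swap (V : lmodType A) b (x y z : V) :
      b *: (x + y) + z = b *: y + (z + b *: x).
    by rewrite scalerDr [b *: x + _]addrC -addrA [b *: x + z]addrC.
  by rewrite exprSr -scalerA swap.
pose L i := sval (cid (adic_series (fun k => s k i) ma)).
have LP n i : adic_small n (P n i - L i).
  exact: (svalP (cid (adic_series (fun k => s k i) ma))) n.
apply/nullP; exists L => i; apply/eqP; rewrite -subr_eq0; apply/eqP.
apply: adic_small0 => n; rewrite (PP n).
have E : diff Y (i + 1) *m P n (i + 1) + P n i *m diff X i -
      (diff Y (i + 1) *m L (i + 1) + L i *m diff X i) =
    diff Y (i + 1) *m (P n (i + 1) - L (i + 1)) + (P n i - L i) *m diff X i.
  by rewrite mulmxBr mulmxBl opprD addrACA.
rewrite -[X in adic_small n X]addrA E.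
apply: adic_smallD; first exact: adic_smallZ.
by apply: adic_smallD; [apply: adic_small_mulmxl | apply: adic_small_mulmxr].
Qed.

End Completeness.

Section Vanishing.
Variables (A : comNzRingType) (m : set A).
Hypotheses (A_local : local_ring m) (A_noeth : noetherian A).
Hypotheses (A_complete : adic_complete m) (A_AR : has_AR_triangles A).

Lemma all_null_koszul_target s (Y X : bcomplex A) : {in s, forall a, m a} ->
  all_null Y (koszul s X) -> all_null Y X.
Proof.
elim: s => //= a s IHs sm YX.
have ma : m a by apply: sm; rewrite inE eqxx.
apply: IHs => [b sb|]; first by apply: sm; rewrite inE sb orbT.
apply: (divisible_all_null A_complete ma) => f.
exact/cone_in_null/YX.
Qed.

(** Undoing one cone at the source shifts the target, so the induction is on
    the statement for all [X] at once, with bounds depending on [X]. *)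
Lemma all_null_koszul_source s (E : nat -> set (bcomplex A)) :
  {in s, forall a, m a} ->
  (forall X, exists c, forall Y, E c Y -> all_null (koszul s Y) X) ->
  forall X, exists c, forall Y, E c Y -> all_null Y X.
Proof.
elim: s => //= a s IHs sm H.
have ma : m a by apply: sm; rewrite inE eqxx.
apply: IHs => [b sb|X]; first by apply: sm; rewrite inE sb orbT.
have [c cP] := H (shift X); exists c => Y EY.
apply: (divisible_all_null A_complete ma) => f.
have [g fg] := cone_out_null (cP Y EY
  (ch_comp (shift_map f) (cone_out (homothety a (koszul s Y))))).
exists g; apply: homotopic_trans fg _; apply: homotopic_eq => i /=.
by rewrite mul_mx_scalar mul_scalar_mx.
Qed.

(** The vanishing provided by AR-triangles concerns maps between complexes with
    finite length cohomology. It is applied to the Koszul complexes of [Y] and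
    [X], and the Koszul complexes are then undone: at the target first, where
    the bound does not change, then at the source. *)
Lemma exact_near0_all_null (X : bcomplex A) :
  exists c, forall Y, exact_near0 Y c -> all_null Y X.
Proof.
have [s ms] := local_fg A_local A_noeth.
have sm : {in s, forall a, m a} by move=> a sa; rewrite ms; exact: ideal_gen_sub.
apply: (all_null_koszul_source (E := fun c Y => exact_near0 Y c) sm) => {}X.
pose K Y : kbf A := Kbf (koszul_finite_length A_local A_noeth Y ms).
have [c cP] := AR_exact_all_null A_local A_noeth A_AR (K X).
exists (c + size s)%N => Y exY; apply: (all_null_koszul_target sm).
exact/(cP (K Y))/koszul_exact.
Qed.

(** * Stalk complexes and free resolutions *)

Lemma stalk_subproof (t : int) (q : nat) i :
  (0 : 'M[A]_(if i == t then q else 0%N, if i + 1 == t then q else 0%N)) *m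
  (0 : 'M[A]_(_, if i + 1 + 1 == t then q else 0%N)) = 0.
Proof. exact: mulmx0. Qed.

Lemma stalk_bounded (t : int) (q : nat) :
  exists n : nat, forall i : int, (n < `|i|)%N -> (if i == t then q else 0%N) = 0%N.
Proof. by exists `|t|%N => i; case: eqP => // ->; rewrite ltnn. Qed.

Definition stalk (t : int) (q : nat) : bcomplex A :=
  BComplex (@stalk_subproof t q) (stalk_bounded t q).

(** The ranks [rk (stalk t q) t] and [q] are equal but not convertible. *)
Lemma stalkE t q : exists (a : 'M[A]_(rk (stalk t q) t, q))
  (b : 'M[A]_(q, rk (stalk t q) t)), a *m b = 1%:M /\ b *m a = 1%:M.
Proof. by rewrite /= eqxx; exists 1%:M, 1%:M; rewrite mulmx1. Qed.

Lemma stalk_rk0 t q i : i != t -> rk (stalk t q) i = 0%N.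
Proof. by move=> /negbTE /= ->. Qed.

(** Maps from [Y] to a stalk complex are cocycles of [Hom(Y, A^q)], and homotopies
    to zero make them coboundaries. *)
Lemma all_null_stalk (Y : bcomplex A) t q : all_null Y (stalk (t + 1) q) ->
  forall F : 'M[A]_(rk Y (t + 1), q), diff Y t *m F = 0 ->
  exists G, F = diff Y (t + 1) *m G.
Proof.
move=> Y0 F dF; have [a [b [_ ba]]] := stalkE (t + 1) q.
pose f := @dfwith _ (fun i => 'M[A]_(rk Y i, rk (stalk (t + 1) q) i))
  (fun=> 0) (t + 1) (F *m b).
have f_comm i : f i *m diff (stalk (t + 1) q) i = diff Y i *m f (i + 1).
  rewrite mulmx0; have [->|it] := eqVneq i t.
    by rewrite /f dfwith_in mulmxA dF mul0mx.
  by rewrite /f dfwith_out ?mulmx0 //; apply: contra it => /eqP; lia.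
have /nullP [s /(_ t)] := Y0 (ChMap f_comm).
rewrite /= mulmx0 addr0 {1}/f dfwith_in => Fb.
by exists (s (t + 1) *m a); rewrite mulmxA -Fb -mulmxA ba mulmx1.
Qed.

End Vanishing.

Lemma thin_mxr (R : Type) m n (M N : 'M[R]_(m, n)) : n = 0%N -> M = N.
Proof. by move=> n0; apply/matrixP; move: n0 M N => -> M N i []. Qed.

Section Cells.
Variable A : comNzRingType.

(** Data for attaching [q] free generators in degree [u] to [Y], with boundaries
    the rows of [G]: the cone of [f] is the enlarged complex. *)
Lemma attach_cells (Y : bcomplex A) (u : int) q (G : 'M[A]_(q, rk Y (u + 1))) :
  G *m diff Y (u + 1) = 0 ->
  exists (S : bcomplex A) (f : chmap S Y) (a : 'M_(rk S (u + 1), q))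
         (b : 'M_(q, rk S (u + 1))),
    [/\ forall i, i != u + 1 -> rk S i = 0%N, f (u + 1) = a *m G & b *m a = 1%:M].
Proof.
move=> Gd; have [a [b [_ ba]]] := stalkE A (u + 1) q.
pose f := @dfwith _ (fun i => 'M[A]_(rk (stalk A (u + 1) q) i, rk Y i))
  (fun=> 0) (u + 1) (a *m G).
have f_comm i : f i *m diff Y i = diff (stalk A (u + 1) q) i *m f (i + 1).
  rewrite mul0mx; have [->|iu] := eqVneq i (u + 1).
    by rewrite /f dfwith_in -mulmxA Gd mulmx0.
  by rewrite /f dfwith_out ?mul0mx // eq_sym.
exists (stalk A (u + 1) q), (ChMap f_comm), a, b; split=> //.
  by move=> i iu; exact: stalk_rk0.
by rewrite /= /f dfwith_in.
Qed.

Lemma cone_exact_above (S Y : bcomplex A) (f : chmap S Y) i :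
  rk S (i + 1 + 1) = 0%N -> exact_at Y i -> exact_at (cone f) i.
Proof.
move=> S0 exY z; rewrite -[z]hsubmxK /= /cone_diff.
move: (lsubmx z) (rsubmx z) => x y; rewrite mul_row_block (thin_mxr x 0 S0).
rewrite !mul0mx !add0r -row_mx0 => /eq_row_mx [_ /exY [y' ->]].
by exists (row_mx 0 y'); rewrite mul_row_block !mul0mx !add0r mulmx0.
Qed.

Lemma cone_exact_cells (S Y : bcomplex A) (f : chmap S Y) u :
  rk S (u + 1 + 1) = 0%N ->
  (forall y : 'rV_(rk Y (u + 1)), y *m diff Y (u + 1) = 0 ->
     exists w, y = w *m f (u + 1)) ->
  exact_at (cone f) u.
Proof.
move=> S0 kerY z; rewrite -[z]hsubmxK /= /cone_diff.
move: (lsubmx z) (rsubmx z) => x y; rewrite mul_row_block (thin_mxr x 0 S0).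
rewrite !mul0mx !add0r -row_mx0 => /eq_row_mx [_ /kerY [w ->]].
exists (row_mx w 0); rewrite mul_row_block !mul0mx !addr0; congr row_mx.
exact: thin_mxr.
Qed.

Hypothesis A_noeth : noetherian A.

(** The free resolution of [A / J] with [A] in degree [t + 1], truncated, is built
    from the stalk complex [A] by attaching generators, first of [J] and then
    of the successive kernels. The matrices [eta] and [eps] compare its term of
    degree [t + 1] with [A] in the place of an equality of ranks. *)
Lemma resolution (J : set A) (t : int) (n : nat) : @submodule A A^o J ->
  exists (Y : bcomplex A) (eta : 'cV[A]_(rk Y (t + 1)))
         (eps : 'rV[A]_(rk Y (t + 1))),
    [/\ eta *m eps = 1%:M,
        forall x, J x <-> exists y : 'rV_(rk Y t), (y *m diff Y t *m eta) 0 0 = x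
      & forall u, t - n%:Z <= u < t -> exact_at Y u].
Proof.
move=> subJ; elim: n => [|n [Y [eta [eps [etaK imJ exY]]]]].
  have [s Js] := A_noeth ((idealP J).2 subJ).
  have [a [b [ab ba]]] := stalkE A (t + 1) 1.
  pose g : 'cV_(size s) := \col_i s`_i.
  have [|S [f [a' [b' [S0 fE b'a']]]]] :=
    @attach_cells (stalk A (t + 1) 1) t (size s) (g *m b); first exact: mulmx0.
  have S2 : rk S (t + 1 + 1) = 0%N by apply: S0; apply/eqP; lia.
  exists (cone f), (col_mx 0 a), (row_mx 0 b); split=> [|x|u]; last by lia.
    rewrite mul_col_row !mul0mx mulmx0 ab [RHS]scalar_mx_block; congr block_mx.
    exact: thin_mx.
  have imE (y1 : 'rV_(rk S (t + 1))) (y2 : 'rV_(rk (stalk A (t + 1) 1) t)) :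
      row_mx y1 y2 *m diff (cone f) t *m col_mx 0 a = y1 *m a' *m g.
    rewrite [diff _ _]/= /cone_diff mul_row_block mul_row_col !mulmx0 add0r addr0 fE.
    by rewrite -!mulmxA ba mulmx1.
  split=> [|[y <-]].
    rewrite Js => /ideal_gen_seqP [c ->]; exists (row_mx (c *m b') 0).
    rewrite imE -(mulmxA c) b'a' mulmx1 !mxE.
    by apply: eq_bigr => i _; rewrite mxE.
  rewrite -[y]hsubmxK imE mxE; apply: (submod_sum subJ) => i.
  apply: (submodZ subJ); rewrite mxE Js; apply: ideal_gen_sub => /=.
  exact: mem_nth.
pose u : int := t - n.+1%:Z.
have [q [G GP]] : exists q (G : 'M_(q, rk Y (u + 1))),
    forall x : 'rV_(rk Y (u + 1)), x *m diff Y (u + 1) = 0 <-> exists y, x = y *m G.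
  apply: (noetherian_rows A_noeth
    (S := fun x : 'rV_(rk Y (u + 1)) => x *m diff Y (u + 1) = 0)).
  split=> [|a x y xd yd]; first exact: mul0mx.
  by rewrite mulmxDl -scalemxAl xd yd scaler0 addr0.
have Gd : G *m diff Y (u + 1) = 0.
  apply/row_matrixP => i; rewrite row0 row_mul; apply/GP.
  by exists (delta_mx 0 i); rewrite rowE.
have [S [f [a' [b' [S0 fE b'a']]]]] := attach_cells Gd.
have S1 : rk S (t + 1) = 0%N by apply: S0; apply/eqP; lia.
have S2 : rk S (t + 1 + 1) = 0%N by apply: S0; apply/eqP; lia.
exists (cone f), (col_mx 0 eta), (row_mx 0 eps); split=> [|x|v vt].
- rewrite mul_col_row !mul0mx mulmx0 etaK [RHS]scalar_mx_block; congr block_mx.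
  exact: thin_mx.
- have imE (y1 : 'rV_(rk S (t + 1))) (y2 : 'rV_(rk Y t)) :
      row_mx y1 y2 *m diff (cone f) t *m col_mx 0 eta = y2 *m diff Y t *m eta.
    rewrite [diff _ _]/= /cone_diff mul_row_block mul_row_col !mulmx0 add0r.
    by rewrite (thin_mxr y1 0 S1) mul0mx add0r.
  split=> [/imJ [y <-]|[y <-]]; first by exists (row_mx 0 y); rewrite imE.
  by rewrite -[y]hsubmxK imE; apply/imJ; exists (rsubmx y).
- have [->|vu] := eqVneq v u.
    apply: cone_exact_cells; first by apply: S0; apply/eqP; lia.
    move=> y /GP [w ->]; exists (w *m b').
    by rewrite fE mulmxA -(mulmxA w) b'a' mulmx1.
  apply: cone_exact_above; first by apply: S0; move/eqP: vu; rewrite /u; lia.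
  by apply: exY; move/eqP: vu; rewrite /u; lia.
Qed.

End Cells.

(** * Baer's criterion *)

Definition linear_on (R : pzRingType) (V W : lmodType R) (S : set V)
    (f : V -> W) : Prop :=
  forall a x y, S x -> S y -> f (a *: x + y) = a *: f x + f y.

(** Injectivity tested on submodules given as sets, with maps defined
    everywhere but linear only there: no module structure on a subset has to
    be built. *)
Definition extension_property (R : comNzRingType) (E : lmodType R) : Prop :=
  forall (V : lmodType R) (S : set V) (f : V -> E), submodule S -> linear_on S f ->
    exists g : {linear V -> E}, forall x, S x -> g x = f x.

Lemma extension_property_injective (R : comNzRingType) (E : lmodType R) :
  extension_property E -> injective_module E.
Proof.
move=> ext U V j f j_inj.
pose S := [set v | exists u, j u = v].
pose h v := if pselect (S v) is left e then f (sval (cid e)) else 0.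
have hj u : h (j u) = f u.
  rewrite /h; case: pselect => [e|]; last by case; exists u.
  by case: (cid e) => u' /= /j_inj ->.
have [||g gP] := ext V S h.
- split=> [|a _ _ [u <-] [u' <-]]; first by exists 0; rewrite raddf0.
  by exists (a *: u + u'); rewrite linearP.
- by move=> a _ _ [u <-] [u' <-]; rewrite -linearP !hj linearP.
by exists g => u; rewrite gP ?hj //; exists u.
Qed.

(** Partial extensions are ordered by inclusion of their graphs. Where a maximal
    one is undefined at [v], the multiples of [v] in its domain form an ideal,
    and an extension from that ideal to the ring gives a value at [v]. *)
Lemma baer_criterion (R : comNzRingType) (E : lmodType R) :
  (forall (J : set R) (f : R -> E), @submodule R R^o J -> @linear_on R R^o E J f ->
     exists e, forall x, J x -> f x = x *: e) ->
  extension_property E.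
Proof.
move=> baer V S f subS f_lin.
pose graph := [set p : V * E | S p.1 /\ p.2 = f p.1].
pose good (G : set (V * E)) :=
  [/\ graph `<=` G, submodule G & forall e, G (0, e) -> e = 0].
have f0 : f 0 = 0.
  have := f_lin (-1) 0 0 subS.1 subS.1.
  by rewrite scaler0 add0r scaleN1r addNr.
have good_graph : good graph.
  split=> //.
    split=> [|a [x _] [y _] [/= Sx ->] [/= Sy ->]]; first by split=> //=; exact: subS.1.
    by split=> /=; [exact: subS.2 | rewrite f_lin].
  by move=> e [_ /= ->].
(* The empty set is the union of the empty chain. *)
pose P G := G = set0 \/ good G.
have [F FP Ftot|M [MP Mmax]] := @Zorn_bigcup _ P.
  have [[G FG G0]|noG] := pselect (exists2 G, F G & G <> set0); last first.
    left; rewrite predeqE => x; split=> // -[G FG Gx].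
    by case: noG; exists G => // G0; rewrite G0 in Gx.
  have goodF K z : F K -> K z -> good K by move=> /FP [->|].
  right; split=> [z gz||e [K FK K0]].
  - by exists G => //; case: (FP G FG) => // -[+ _ _]; apply.
  - split; first by exists G => //; case: (FP G FG) => // -[_ [] ].
    move=> a x y [K FK Kx] [L FL Ly].
    case: (Ftot K L FK FL) => [KL|LK].
      by exists L => //; have [_ [_ h] _] := goodF L y FL Ly; apply: h => //; exact: KL.
    by exists K => //; have [_ [_ h] _] := goodF K x FK Kx; apply: h => //; apply: LK.
  - by have [_ _] := goodF K _ FK K0; apply.
have {MP} [gM subM funM] : good M.
  case: MP => // M0; exfalso; apply: (Mmax graph); last by right.
  rewrite M0; split=> // /(_ (0, 0)); apply.
  by split; [exact: subS.1 | rewrite f0].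
have M_uniq x y y' : M (x, y) -> M (x, y') -> y = y'.
  move=> Mxy Mxy'; apply/eqP; rewrite -subr_eq0; apply/eqP; apply: funM.
  have -> : (0, y - y') = (x, y) - (x, y') :> V * E.
    by apply: injective_projections; rewrite //= subrr.
  exact: submodB.
have Mtot v : exists e, M (v, e).
  apply: contrapT => nov.
  pose J := [set a : R | exists e, M (a *: v, e)].
  have subJ : @submodule R R^o J.
    split=> [|a x y [e Me] [e' Me']]; first by exists 0; rewrite scale0r; exact: subM.1.
    exists (a *: e + e'); rewrite scalerDl -scalerA.
    exact: (subM.2 a _ _ Me Me').
  pose g a := if pselect (J a) is left h then sval (cid h) else 0.
  have gP a : J a -> M (a *: v, g a).
    by move=> Ja; rewrite /g; case: pselect => // h; case: (cid h).
  have g_lin : @linear_on R R^o E J g.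
    move=> a x y Jx Jy; apply: M_uniq (gP _ _) _; first exact: subJ.2.
    rewrite scalerDl -scalerA; exact: (subM.2 a _ _ (gP x Jx) (gP y Jy)).
  have [e eP] := baer J g subJ g_lin.
  pose M' := [set p : V * E | exists a x, M x /\ p = (a *: v, a *: e) + x].
  have MM' : M `<=` M'.
    by move=> x Mx; exists 0, x; split=> //; rewrite !scale0r; exact/esym/add0r.
  apply: (Mmax M'); last first.
    right; split; first exact: subset_trans MM'.
    - split; first by apply: MM'; exact: subM.1.
      move=> b _ _ [a [x [Mx ->]]] [a' [x' [Mx' ->]]].
      exists (b * a + a'), (b *: x + x'); split; first exact: subM.2.
      by rewrite !scalerDl -!scalerA scalerDr addrACA.
    - move=> e' [a [[x y] [Mxy [x0 ->]]]].
      have {}x0 : x = - (a *: v) by apply/eqP; rewrite -addr_eq0 addrC -x0.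
      have Ma : M (a *: v, - y).
        have -> : (a *: v, - y) = - (x, y) :> V * E.
          by apply: injective_projections; rewrite //= x0 opprK.
        exact: submodN.
      have Ja : J a by exists (- y).
      by rewrite -eP // -(M_uniq _ _ _ Ma (gP a Ja)) addNr.
  split=> // M'M; apply: nov; exists e; apply: M'M.
  exists 1, 0; split; first exact: subM.1.
  by rewrite !scale1r addr0.
have [g gP] := choice Mtot.
have g_lin : linear g.
  move=> a x y; apply: M_uniq (gP _) _; exact: (subM.2 a _ _ (gP x) (gP y)).
pose g' : {linear V -> E} := HB.pack g (GRing.isLinear.Build R V E *:%R g g_lin).
by exists g' => x Sx; apply: M_uniq (gP x) _; exact: gM.
Qed.

(** * The divisible group Q/Z *)

Definition rat_int (x : rat) : bool := x \is a Num.int.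
Lemma rat_int_zmod : zmod_closed rat_int.
Proof.
by split=> [|x y]; rewrite /in_mem /= /rat_int; [exact: rpred0 | exact: rpredB].
Qed.
HB.instance Definition _ := GRing.isZmodClosed.Build rat rat_int rat_int_zmod.

Definition rat_mod_int : zmodType :=
  Quotient.quot (GRing.ZmodClosed.clone rat rat_int _).

Definition piQ : {additive rat -> rat_mod_int} := (\pi_rat_mod_int)%qT.

Lemma piQ_surj y : exists x, piQ x = y.
Proof. by exists (repr y); rewrite /= reprK. Qed.

Lemma piQ_eq0 x : (piQ x == 0) = (x \is a Num.int).
Proof.
rewrite -(raddf0 piQ).
have /esym := @Quotient.idealrBE _ (GRing.ZmodClosed.clone rat rat_int _) x 0.
by rewrite subr0.
Qed.

Lemma rat_mod_int_divisible (n : int) (y : rat_mod_int) : n != 0 ->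
  exists z, z *~ n = y.
Proof.
move=> n0; have [x <-] := piQ_surj y; exists (piQ (x / n%:~R)).
by rewrite -raddfMz -mulrzr divfK // intr_eq0.
Qed.

Lemma rat_mod_int_torsion (n : int) : `|n|%N != 1%N ->
  exists z : rat_mod_int, z != 0 /\ z *~ n = 0.
Proof.
move=> n1; have [->|n0] := eqVneq n 0.
  exists (piQ 2^-1); rewrite piQ_eq0 mulr0z; split=> //.
exists (piQ n%:~R^-1); rewrite -raddfMz piQ_eq0 -[_^-1 *~ n]mulrzr mulVf ?intr_eq0 //.
split; last by apply/eqP; rewrite piQ_eq0.
apply: contra n1 => /intrP [k kE].
have /eqP : (n%:~R * k%:~R : rat) = 1 by rewrite -kE mulfV ?intr_eq0.
rewrite -intrM -[1]/(1%:~R) eqr_int => /eqP nk.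
by have := congr1 absz nk; rewrite abszM => /eqP; rewrite muln_eq1 => /andP [].
Qed.

Lemma int_ideal_principal (J : set int) : @submodule int int^o J ->
  exists d : int, forall x, J x <-> exists c, x = c * d.
Proof.
move=> subJ; have [[x Jx x0]|noJ] := pselect (exists2 x, J x & x != 0); last first.
  exists 0 => x; split=> [Jx|[c ->]]; last by rewrite mulr0; exact: subJ.1.
  exists 0; rewrite mul0r; apply/eqP; apply: contrapT => /negP x0.
  by apply: noJ; exists x.
have exJ : exists n, (0 < n)%N && `[< J n%:Z >].
  exists `|x|%N; rewrite absz_gt0 x0; apply/asboolP.
  have [->|->] : `|x|%N%:Z = x \/ `|x|%N%:Z = - x by lia.
    by [].
  exact: (submodN subJ).
have [d /andP [d0 /asboolP Jd] dmin] := ex_minnP exJ.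
exists d%:Z => y; split=> [Jy|[c ->]]; last exact: (submodZ subJ).
exists (y %/ d)%Z; have dE := divz_eq y d.
have r0 : 0 <= (y %% d)%Z by apply: modz_ge0; rewrite eqz_nat -lt0n.
have rd : (y %% d)%Z < d%:Z by rewrite ltz_pmod // ltz_nat.
have Jr : J (y %% d)%Z.
  have -> : (y %% d)%Z = y - (y %/ d)%Z * d by rewrite {2}dE addrC addKr.
  by apply: (submodB subJ) => //; exact: (submodZ subJ).
case: (y %% d)%Z r0 rd Jr dE => // r _ rd Jr dE.
have [r0|r0] := posnP r; first by rewrite {1}dE r0 addr0.
have : (d <= r)%N by apply: dmin; rewrite r0; apply/asboolP.
by lia.
Qed.

Lemma rat_mod_int_extension : extension_property (zmodule rat_mod_int).
Proof.
apply: baer_criterion => J f subJ f_lin.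
have [d dP] := int_ideal_principal subJ.
have fd c : J d -> f (c * d) = f d *~ c.
  move=> Jd; have f0 : f 0 = 0.
    have := f_lin (-1) 0 0 subJ.1 subJ.1.
    by rewrite scaler0 add0r scaleN1r addNr.
  by have := f_lin c d 0 Jd subJ.1; rewrite !addr0 f0 addr0.
have Jd : J d by apply/dP; exists 1; rewrite mul1r.
have [d0|d0] := eqVneq d 0.
  exists 0 => x /dP [c ->]; rewrite scaler0 d0 mulr0.
  by have := fd 0 Jd; rewrite mul0r mulr0z.
have [e eP] := rat_mod_int_divisible (f d) d0.
exists e => x /dP [c ->]; rewrite fd // -eP scalezrE -mulrzA.
by rewrite mulrC.
Qed.

(** The multiples of [x] lying in [S] are the multiples of some [d * x] with
    [d <> 1, -1]. Sending [x] to a nonzero element killed by [d] defines a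
    character on the group generated by [S] and [x], which extends to [V]. *)
Lemma character_separation (V : zmodType) (S : set V) (x : V) :
  @submodule int (zmodule V) S -> ~ S x ->
  exists ch : V -> rat_mod_int,
    [/\ forall y z, ch (y + z) = ch y + ch z, forall y, S y -> ch y = 0 & ch x != 0].
Proof.
move=> subS Sx; pose J := [set k : int | S (x *~ k)].
have subJ : @submodule int int^o J.
  split=> [|a k l Jk Jl]; first by rewrite /J /= mulr0z; exact: subS.1.
  rewrite /J /= mulrzDr -[a *: k]/(a * k) -mulrzA_C; exact: subS.2.
have [d dP] := int_ideal_principal subJ.
have [|q [q0 qd]] := @rat_mod_int_torsion d.
  apply/eqP => d1; apply: Sx; rewrite -[x]mulr1z; apply/dP.
  have [->|->] : d = 1 \/ d = -1 by lia.
    by exists 1.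
  by exists (-1).
have qJ k : S (x *~ k) -> q *~ k = 0.
  by move=> /dP [c ->]; rewrite mulrC mulrzA qd mul0rz.
pose U := [set v : zmodule V | exists k, S (v - x *~ k)].
(* [f] sends [s + x *~ k], for [s] in [S], to [q *~ k]. *)
pose f (v : zmodule V) : zmodule rat_mod_int :=
  if pselect (U v) is left h then q *~ (sval (cid h)) else 0.
have fE v k : S (v - x *~ k) -> f v = q *~ k.
  move=> Sv; rewrite /f; case: pselect => [h|]; last by case; exists k.
  case: (cid h) => l /= Sl; apply/eqP; rewrite -subr_eq0 -mulrzBr; apply/eqP/qJ.
  rewrite mulrzBr; have := submodB subS Sv Sl.
  by rewrite opprB addrC subrKA.
have SZD a (v w : zmodule V) k l : S (v - x *~ k) -> S (w - x *~ l) ->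
    S (a *: v + w - x *~ (a * k + l)).
  move=> Sv Sw; rewrite mulrzDr -mulrzA_C opprD addrACA -[_ *~ a]scalezrE.
  by rewrite -scalerBr; exact: subS.2.
have [||g gP] := rat_mod_int_extension (V := zmodule V) (S := U) (f := f).
- split=> [|a v w [k Sv] [l Sw]]; first by exists 0; rewrite subr0; exact: subS.1.
  by exists (a * k + l); exact: SZD.
- move=> a v w [k Sv] [l Sw]; rewrite (fE v k) // (fE w l) //.
  rewrite (fE _ (a * k + l)); last exact: SZD.
  by rewrite mulrzDr -mulrzA_C.
exists g; split=> [y z|y Sy|]; first exact: (raddfD g).
  rewrite gP; last by exists 0; rewrite subr0.
  by rewrite (fE y 0) // subr0.
rewrite gP; last by exists 1; rewrite subrr; exact: subS.1.
by rewrite (fE x 1) // subrr; exact: subS.1.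
Qed.

(** * Injective modules and injective dimension *)

(** The [A]-module [Hom(A, D)^T] of families of additive maps. Coinduction from
    the integers to [A] turns divisible groups into injective modules; the
    product over [T] makes room for all characters of a module. *)
Section Coinduced.
Variables (A : comNzRingType) (T : Type) (D : zmodType).

Record coinduced := Coinduced {
  coind_fun :> T -> A -> D;
  coind_additive : forall t a b, coind_fun t (a + b) = coind_fun t a + coind_fun t b
}.

Lemma coind_eq (f g : coinduced) : (forall t a, f t a = g t a) -> f = g.
Proof.
case: f g => f fD [g gD] /= fg.
have {}fg : f = g by apply: funext => t; apply: funext => a.
by subst g; congr Coinduced; exact: Prop_irrelevance.
Qed.

HB.instance Definition _ := gen_eqMixin coinduced.
HB.instance Definition _ := gen_choiceMixin coinduced.

Lemma coind0_subproof (t : T) (a b : A) : (0 : D) = 0 + 0.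
Proof. by rewrite addr0. Qed.
Definition coind0 : coinduced := @Coinduced (fun _ _ => 0) coind0_subproof.

Lemma coindN_subproof (f : coinduced) t a b : - f t (a + b) = - f t a + - f t b.
Proof. by rewrite coind_additive opprD. Qed.
Definition coindN (f : coinduced) :=
  @Coinduced (fun t a => - f t a) (coindN_subproof f).

Lemma coindD_subproof (f g : coinduced) t a b :
  f t (a + b) + g t (a + b) = (f t a + g t a) + (f t b + g t b).
Proof. by rewrite !coind_additive addrACA. Qed.
Definition coindD (f g : coinduced) :=
  @Coinduced (fun t a => f t a + g t a) (coindD_subproof f g).

Lemma coindDA : associative coindD.
Proof. by move=> f g h; apply: coind_eq => t a /=; rewrite addrA. Qed.
Lemma coindDC : commutative coindD.
Proof. by move=> f g; apply: coind_eq => t a /=; rewrite addrC. Qed.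
Lemma coind0D : left_id coind0 coindD.
Proof. by move=> f; apply: coind_eq => t a /=; rewrite add0r. Qed.
Lemma coindND : left_inverse coind0 coindN coindD.
Proof. by move=> f; apply: coind_eq => t a /=; rewrite addNr. Qed.

HB.instance Definition _ :=
  GRing.isZmodule.Build coinduced coindDA coindDC coind0D coindND.

Lemma coindZ_subproof c (f : coinduced) t a b :
  f t ((a + b) * c) = f t (a * c) + f t (b * c).
Proof. by rewrite mulrDl coind_additive. Qed.
Definition coindZ c (f : coinduced) :=
  @Coinduced (fun t a => f t (a * c)) (coindZ_subproof c f).

Lemma coindZA a b f : coindZ a (coindZ b f) = coindZ (a * b) f.
Proof. by apply: coind_eq => t c /=; rewrite mulrA. Qed.
Lemma coind1Z : left_id 1 coindZ.
Proof. by move=> f; apply: coind_eq => t a /=; rewrite mulr1. Qed.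
Lemma coindZDr : right_distributive coindZ +%R.
Proof. by move=> c f g; apply: coind_eq. Qed.
Lemma coindZDl f : {morph coindZ^~ f : a b / a + b}.
Proof. by move=> a b; apply: coind_eq => t c /=; rewrite mulrDr coind_additive. Qed.

HB.instance Definition _ :=
  GRing.Zmodule_isLmodule.Build A coinduced coindZA coind1Z coindZDr coindZDl.

End Coinduced.

Section Injectives.
Variable A : comNzRingType.

(** An [A]-linear map [f] into [Hom(A, D)] is determined by the additive map
    [x |-> f x 1] into [D], and additive maps into Q/Z extend. *)
Lemma coinduced_extension (T : Type) :
  extension_property (coinduced A T rat_mod_int : lmodType A).
Proof.
move=> V S f subS f_lin.
have fD x y : S x -> S y -> f (x + y) = f x + f y.
  by move=> Sx Sy; have := f_lin 1 x y Sx Sy; rewrite !scale1r.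
have f0 : f 0 = 0.
  have := f_lin (-1) 0 0 subS.1 subS.1.
  by rewrite scaler0 add0r scaleN1r addNr.
have fZ a x : S x -> f (a *: x) = a *: f x.
  by move=> Sx; have := f_lin a x 0 Sx subS.1; rewrite f0 !addr0.
have fN x : S x -> f (- x) = - f x by move=> /(fZ (-1)); rewrite !scaleN1r.
have ext t : exists h : V -> rat_mod_int,
    (forall x y, h (x + y) = h x + h y) /\ forall x, S x -> h x = f x t 1.
  pose ft (x : zmodule V) : zmodule rat_mod_int := f x t 1.
  have SMz a (x : V) : S x -> S (x *~ a).
    by move=> Sx; rewrite -scaler_int; exact: submodZ.
  have fMz a (x : V) : S x -> f (x *~ a) t 1 = f x t 1 *~ a.
    move=> Sx.
    have fMn n : f (x *+ n) t 1 = f x t 1 *+ n.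
      elim: n => [|n IHn]; first by rewrite f0.
      rewrite !mulrS fD ?[LHS]/(_ + _) ?IHn //.
      by rewrite -scaler_nat; exact: submodZ.
    case: a => n; first exact: fMn.
    rewrite NegzE !mulrNz fN; last exact: (SMz n.+1%:Z).
    by rewrite [LHS]/(- _) fMn.
  have [||h hP] := rat_mod_int_extension (V := zmodule V) (S := S) (f := ft).
  - split=> [|a x y Sx Sy]; first exact: subS.1.
    by apply: (submodD subS) => //; exact: SMz.
  - move=> a x y Sx Sy; rewrite /ft [a *: x]scalezrE fD //; last exact: SMz.
    by rewrite [LHS]/(_ + _) fMz.
  by exists h; split=> // x y; exact: (raddfD h).
have [h hP] := choice ext.
have h_add x t a b : h t ((a + b) *: x) = h t (a *: x) + h t (b *: x).
  by rewrite scalerDl (hP t).1.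
pose g x : coinduced A T rat_mod_int := Coinduced (h_add x).
have g_lin : linear g.
  move=> a x y; apply: coind_eq => t b /=.
  by rewrite scalerDr scalerA (hP t).1.
pose g' : {linear V -> coinduced A T rat_mod_int} :=
  HB.pack g (GRing.isLinear.Build A V _ *:%R g g_lin).
exists g' => x Sx; apply: coind_eq => t a /=.
by rewrite (hP t).2 ?fZ //=; [rewrite mul1r | exact: submodZ].
Qed.

(** [V] embeds into the product over all its characters. *)
Lemma enough_injectives (V : lmodType A) :
  exists (E : lmodType A) (e : {linear V -> E}), extension_property E /\ injective e.
Proof.
pose T := {ch : V -> rat_mod_int | forall x y, ch (x + y) = ch x + ch y}.
have ev_add (x : V) (t : T) a b :
    sval t ((a + b) *: x) = sval t (a *: x) + sval t (b *: x).
  by rewrite scalerDl (svalP t).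
pose ev x : coinduced A T rat_mod_int := Coinduced (ev_add x).
have ev_lin : linear ev.
  move=> a x y; apply: coind_eq => t b /=.
  by rewrite scalerDr scalerA (svalP t).
pose e : {linear V -> coinduced A T rat_mod_int} :=
  HB.pack ev (GRing.isLinear.Build A V _ *:%R ev ev_lin).
exists (coinduced A T rat_mod_int : lmodType A), e.
split; first exact: coinduced_extension.
apply: raddf_inj => x ex0; apply: contrapT => x0.
have [|ch [chD _ /eqP]] := @character_separation V [set 0] x _ x0.
  by split=> [//|a y z /= -> ->]; rewrite scaler0 addr0.
apply; have := congr1 (fun u : coinduced A T rat_mod_int =>
  u (exist _ ch chD) 1) ex0.
by rewrite /= scale1r.
Qed.

(** The cosyzygies of a module are quotients; scalars act through
    representatives. *)
Lemma quotient_module (V : lmodType A) (S : set V) : submodule S ->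
  exists (Q : lmodType A) (q : {linear V -> Q}),
    (forall x, q x = 0 <-> S x) /\ (forall y, exists x, q x = y).
Proof.
move=> subS; pose P (x : V) := `[< S x >].
have P_zmod : zmod_closed P.
  split=> [|x y /asboolP Sx /asboolP Sy]; apply/asboolP; first exact: subS.1.
  exact: submodB.
pose I : zmodClosed V := HB.pack P (GRing.isZmodClosed.Build V P P_zmod).
pose Q : zmodType := Quotient.quot I.
pose pi : {additive V -> Q} := (\pi_Q)%qT.
have piE x y : (pi x == pi y) = `[< S (x - y) >].
  by have /esym := @Quotient.idealrBE _ I x y.
have pi0 x : pi x = 0 <-> S x.
  rewrite -(raddf0 pi); split=> [/eqP|Sx]; first by rewrite piE subr0 => /asboolP.
  by apply/eqP; rewrite piE subr0; apply/asboolP.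
have pi_surj (y : Q) : exists x, pi x = y by exists (repr y); rewrite /= reprK.
pose sc a (y : Q) : Q := pi (a *: repr y).
have scE a x : sc a (pi x) = pi (a *: x).
  apply/eqP; rewrite piE -scalerBr; apply/asboolP; apply: (submodZ subS).
  have : pi (repr (pi x)) == pi x by rewrite /= reprK.
  by rewrite piE => /asboolP.
have scA a b y : sc a (sc b y) = sc (a * b) y.
  by have [x <-] := pi_surj y; rewrite !scE scalerA.
have sc1 : left_id 1 sc.
  by move=> y; have [x <-] := pi_surj y; rewrite !scE scale1r.
have scDr : right_distributive sc +%R.
  move=> a y z; have [x <-] := pi_surj y; have [x' <-] := pi_surj z.
  by rewrite -raddfD !scE scalerDr raddfD.
have scDl y : {morph sc^~ y : a b / a + b}.
  by move=> a b; have [x <-] := pi_surj y; rewrite !scE scalerDl raddfD.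
pose QM : lmodType A := HB.pack (Quotient.quot I)
  (GRing.Zmodule_isLmodule.Build A (Quotient.quot I) scA sc1 scDr scDl).
have pi_lin : linear (pi : V -> QM).
  by move=> a x y; rewrite raddfD; congr (_ + _); exact/esym/scE.
pose q : {linear V -> QM} := HB.pack (pi : V -> QM)
  (GRing.isLinear.Build A V QM *:%R (pi : V -> QM) pi_lin).
by exists QM, q.
Qed.

Lemma injdim_le_injective (C : lmodType A) : extension_property C -> injdim_le C 0.
Proof.
move=> extC.
pose I (k : nat) : lmodType A := if k is 0%N then C else 'rV[A]_0.
exists I, (idfun : {linear C -> I 0%N}), (fun k => (\0 : {linear I k -> I k.+1})).
have I0 k (x y : I k.+1) : x = y by apply/rowP => -[].
split=> // [[|k]|[|k]//|x|k x].
- exact: extension_property_injective.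
- by move=> U V j f _; exists (\0 : {linear V -> I k.+1}) => x; exact: I0.
- by split=> // _; exists x.
- by split=> // _; exists 0; exact: I0.
Qed.

Lemma injdim_le_step (C E Q : lmodType A) (e : {linear C -> E})
    (q : {linear E -> Q}) n :
  extension_property E -> injective e ->
  (forall x, q x = 0 <-> exists y, e y = x) ->
  (forall y, exists x, q x = y) -> injdim_le Q n -> injdim_le C n.+1.
Proof.
move=> extE e_inj qe q_surj [I [i [d [inj_I I0 i_inj id dd]]]].
pose J (k : nat) : lmodType A := if k is l.+1 then I l else E.
pose dJ k : {linear J k -> J k.+1} :=
  if k is l.+1 return {linear J k -> J k.+1} then d l
  else (i \o q : {linear E -> I 0%N}).
exists J, e, dJ; split=> [[|k]|[//|k]|//|x|[|k] x]; rewrite ?ltnS.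
- exact: extension_property_injective.
- exact: inj_I.
- exact: I0.
- rewrite -qe /=; split=> [|->]; last exact: raddf0.
  by rewrite -(raddf0 i) => /i_inj.
- split=> [/id [y <-]|[y <-]]; last by apply/id; exists (q y).
  by have [z <-] := q_surj y; exists z.
- exact: dd.
Qed.

End Injectives.

(** * Dimension shifting *)

Section DimensionShift.
Variable A : comNzRingType.

Lemma free_lift (E Q : lmodType A) (q : {linear E -> Q}) p
    (f : {linear 'rV[A]_p -> Q}) :
  (forall y, exists x, q x = y) ->
  exists g : {linear 'rV[A]_p -> E}, forall x, q (g x) = f x.
Proof.
move=> q_surj; have [e eP] := choice (fun i => q_surj (f (delta_mx 0 i))).
pose g (x : 'rV[A]_p) := \sum_i x 0 i *: e i.
have g_lin : linear g.
  move=> a x y; rewrite /g scaler_sumr -big_split; apply: eq_bigr => i _ /=.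
  by rewrite !mxE scalerDl scalerA.
pose g' : {linear 'rV[A]_p -> E} :=
  HB.pack g (GRing.isLinear.Build A _ E *:%R g g_lin).
exists g' => x; rewrite [in RHS](row_sum_delta x) !linear_sum; apply: eq_bigr => i _.
by rewrite !linearZ eP.
Qed.

Lemma extension_along_mx (E : lmodType A) p r (M : 'M[A]_(p, r))
    (g : {linear 'rV[A]_p -> E}) :
  extension_property E -> (forall z, z *m M = 0 -> g z = 0) ->
  exists h : {linear 'rV[A]_r -> E}, forall x, g x = h (x *m M).
Proof.
move=> extE gM; pose S := [set v : 'rV[A]_r | exists z, v = z *m M].
have [h0 h0P] : exists h0 : 'rV[A]_r -> E, forall z, h0 (z *m M) = g z.
  have ex v : exists w, forall z, v = z *m M -> w = g z.
    have [[z ->]|noz] := pselect (exists z, v = z *m M); last first.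
      by exists 0 => z vz; case: noz; exists z.
    exists (g z) => z' zz'; apply/eqP; rewrite -subr_eq0 -raddfB; apply/eqP/gM.
    by rewrite mulmxBl zz' subrr.
  by have [h0 h0P] := choice ex; exists h0 => z; apply: h0P.
have [||h hP] := extE 'rV[A]_r S h0.
- split=> [|a _ _ [x ->] [y ->]]; first by exists 0; rewrite mul0mx.
  by exists (a *: x + y); rewrite mulmxDl scalemxAl.
- by move=> a _ _ [x ->] [y ->]; rewrite scalemxAl -mulmxDl !h0P linearP.
by exists h => x; rewrite hP ?h0P //; exists x.
Qed.

(** The cohomology of [Hom(Y, C)] vanishes at the degree [t + 1] of [Y]. For [Y] a
    resolution of [A / J], this is the vanishing of a group [Ext(A / J, C)], whose
    degree depends on the shift of the resolution. *)
Definition cocycles_bound (C : lmodType A) (t : int) (c : nat) : Prop :=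
  forall Y : bcomplex A, exact_near0 Y c ->
  forall f : {linear 'rV[A]_(rk Y (t + 1)) -> C},
    (forall y, f (y *m diff Y t) = 0) ->
  exists g : {linear 'rV[A]_(rk Y (t + 1 + 1)) -> C},
    forall x, f x = g (x *m diff Y (t + 1)).

Lemma all_null_cocycles_bound t c :
  (forall Y, exact_near0 Y c -> all_null Y (stalk A (t + 1) 1)) ->
  cocycles_bound A^o t c.
Proof.
move=> H Y exY f f_cocycle.
pose F : 'cV_(rk Y (t + 1)) := \col_i f (delta_mx 0 i).
have fE x : f x = (x *m F) 0 0.
  rewrite {1}(row_sum_delta x) linear_sum mxE; apply: eq_bigr => i _.
  by rewrite linearZ mxE.
have [|G FG] := all_null_stalk (H Y exY) (F := F).
  apply/row_matrixP => i; apply/rowP => j; rewrite row_mul rowE ord1 -fE f_cocycle.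
  by rewrite row0 mxE.
pose g (x : 'rV_(rk Y (t + 1 + 1))) : A^o := (x *m G) 0 0.
have g_lin : linear g by move=> a x y; rewrite /g mulmxDl -scalemxAl !mxE.
pose g' : {linear 'rV_(rk Y (t + 1 + 1)) -> A^o} :=
  HB.pack g (GRing.isLinear.Build A _ A^o *:%R g g_lin).
by exists g' => x; rewrite fE FG /= /g mulmxA.
Qed.

(** Dimension shifting along [0 -> C -> E -> Q -> 0]: lift a cocycle [f] with
    values in [Q] to [b] with values in [E]. Its coboundary is a cocycle with
    values in [C], hence that of some [g] with values in [C], and [b - g] is a
    cocycle with values in the injective module [E], hence a coboundary. *)
Lemma cocycles_bound_shift (C E Q : lmodType A) (e : {linear C -> E})
    (q : {linear E -> Q}) t c :
  extension_property E -> injective e ->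
  (forall x, q x = 0 <-> exists y, e y = x) ->
  (forall y, exists x, q x = y) -> (`|(t + 1)%R| <= c)%N ->
  cocycles_bound C t c -> cocycles_bound Q (t + 1) c.
Proof.
move=> extE e_inj qe q_surj tc CC Y exY f f_cocycle.
have [b bP] := free_lift f q_surj.
have /choice [al alP] (y : 'rV[A]_(rk Y (t + 1))) :
    exists z, e z = b (y *m diff Y (t + 1)).
  by apply/qe; rewrite bP.
have al_lin : linear al.
  by move=> a x y; apply: e_inj; rewrite linearP !alP mulmxDl -scalemxAl linearP.
pose al' : {linear 'rV_(rk Y (t + 1)) -> C} :=
  HB.pack al (GRing.isLinear.Build A _ C *:%R al al_lin).
have [|g gP] := CC Y exY al'.
  by move=> y; apply: e_inj; rewrite /= alP -mulmxA diff_diff mulmx0 !raddf0.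
have [z zd|h hP] :=
  extension_along_mx (M := diff Y (t + 1 + 1)) (g := b \- (e \o g)) extE.
  have [y ->] := exY _ tc z zd.
  by rewrite /= -alP -gP subrr.
exists (q \o h : {linear _ -> _}) => x /=.
rewrite -hP /= linearB bP [X in _ - X](_ : _ = 0) ?subr0 //.
by apply/qe; exists (g x).
Qed.

(** By Baer's criterion: a linear map [f] on [J] gives a cocycle on the
    resolution of [A / J], through the generators of [J], and writing it as a
    coboundary extends [f] to [A]. *)
Lemma cocycles_bound_injective (C : lmodType A) c : noetherian A ->
  cocycles_bound C c%:Z c -> extension_property C.
Proof.
move=> A_noeth CC; apply: baer_criterion => J f subJ f_lin.
have [Y [eta [eps [etaK imJ exY]]]] := resolution A_noeth (c%:Z + 1) c.*2.+1 subJ.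
have {}exY : exact_near0 Y c by move=> u uc; apply: exY; lia.
pose j (y : 'rV_(rk Y (c%:Z + 1))) := (y *m diff Y (c%:Z + 1) *m eta) 0 0.
have Jj y : J (j y) by apply/imJ; exists y.
have j_lin a x y : j (a *: x + y) = a * j x + j y.
  by rewrite /j !mulmxDl -!scalemxAl !mxE.
pose fj y := f (j y).
have fj_lin : linear fj by move=> a x y; rewrite /fj j_lin; exact: f_lin.
pose fj' : {linear 'rV_(rk Y (c%:Z + 1)) -> C} :=
  HB.pack fj (GRing.isLinear.Build A _ C *:%R fj fj_lin).
have [|g gP] := CC Y exY fj'.
  move=> y; rewrite -(raddf0 fj') /= /fj; congr f.
  by rewrite /j -(mulmxA y) diff_diff mulmx0 !mul0mx.
exists (g eps) => x /imJ [y yx].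
rewrite -yx -[LHS]/(fj' y) gP -linearZ; congr (g _).
by rewrite -mul_scalar_mx -mx11_scalar -mulmxA etaK mulmx1.
Qed.

(** Each step up the injective resolution raises the degree of the vanishing
    cohomology by one; at degree [c] the cosyzygy is injective. *)
Lemma cocycles_bound_injdim (C : lmodType A) c n : noetherian A -> (n <= c)%N ->
  cocycles_bound C (c%:Z - n%:Z) c -> injdim_le C n.
Proof.
move=> A_noeth; elim: n C => [|n IHn] C nc CC.
  rewrite subr0 in CC; apply: injdim_le_injective.
    exact: cocycles_bound_injective CC.
have [E [e [extE e_inj]]] := enough_injectives C.
have [|Q [q [qS q_surj]]] := quotient_module (S := [set x | exists y, e y = x]).
  split=> [|a _ _ [x <-] [y <-]]; first by exists 0; rewrite raddf0.
  by exists (a *: x + y); rewrite linearP.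
apply: (injdim_le_step extE e_inj qS q_surj); apply: IHn; first exact: ltnW.
have -> : c%:Z - n%:Z = c%:Z - n.+1%:Z + 1 by lia.
by apply: (cocycles_bound_shift extE e_inj qS q_surj _ CC); lia.
Qed.

End DimensionShift.

Lemma AR_gorenstein (A : comNzRingType) (m : set A) :
  local_ring m -> noetherian A -> adic_complete m -> has_AR_triangles A ->
  gorenstein A.
Proof.
move=> A_local A_noeth A_complete A_AR.
have [c cP] :=
  exact_near0_all_null A_local A_noeth A_complete A_AR (stalk A (0 + 1) 1).
exists c; apply: (@cocycles_bound_injdim A A^o c c A_noeth (leqnn c)).
by rewrite subrr; exact: all_null_cocycles_bound.
Qed.

Theorem theorem1p5 (A : comNzRingType) (m : set A)
    (A_local : local_ring m) (A_noetherian : noetherian A)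
    (A_complete : adic_complete m) (A_AR : has_AR_triangles A) :
  (cohen_macaulay m -> gorenstein A) /\ (krull_dim A 1 -> gorenstein A).
Proof.
have gorA := AR_gorenstein A_local A_noetherian A_complete A_AR.
by split=> _.
Qed.
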